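(* Let $\Sigma$ be an arbitrary origami surface with origami datum $(m,\sigma,\tau)$, let $k\geqslant2$ be a multiple of the orders of $\sigma$ and $\tau$, let $\mathbb{F}_2=\langle a_k,b_k\rangle\curvearrowright\Sigma$ be the associated multi-twist action, and let $(\Gamma_n)_n$ be an expander that is (uniformly) quasi-isometric to the warped cone $\mathcal{O}_{\mathbb{F}_2}\Sigma$ over this action. Then $(\Gamma_n)_n$ does not admit a coarse embedding into any Selberg-type expander.
   Context: Origami surfaces. An origami datum is a triple $(m,\sigma,\tau)$ with $m\geqslant1$ and $\sigma,\tau$ permutations of $\{1,\dots,m\}$ generating a transitive group. The associated origami surface $\Sigma$ is obtained from copies $P_1,\dots,P_m$ of $[0,1]^2$, with identifying homeomorphisms $\rho_i\colon P_i\to[0,1]^2$, by gluing, for every $i$, the left side of $P_i$ to the right side of $P_{\sigma(i)}$ and the top side of $P_i$ to the bottom side of $P_{\tau(i)}$, by translation. It carries the length metric and the normalised Lebesgue measure inherited from the squares. Multi-twist action. Let $k\geqslant2$ be a multiple of the orders of $\sigma$ and $\tau$, $a_k=\begin{pmatrix}1&k\\0&1\end{pmatrix}$, $b_k=\begin{pmatrix}1&0\\k&1\end{pmatrix}$; these freely generate a free group $\mathbb{F}_2\leqslant\mathrm{SL}_2(\mathbb{Z})$. Define $h_i\colon\mathbb{R}\times[0,1]\to\Sigma$ by $h_i(x,y)=\rho_{\sigma^{-j}(i)}^{-1}(x-j,y)$ for $x\in[j,j+1]$, $j\in\mathbb{Z}$, and $v_i\colon[0,1]\times\mathbb{R}\to\Sigma$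 by $v_i(x,y)=\rho_{\tau^{j}(i)}^{-1}(x,y-j)$ for $y\in[j,j+1]$. The generators act on $p\in P_i$ by $a_k.p=h_i(a_k\rho_i(p))$ and $b_k.p=v_i(b_k\rho_i(p))$; this is a well-defined action of $\mathbb{F}_2$ by Lipschitz measure-preserving homeomorphisms (with spectral gap). Warped cone. For a compact metric space $(Y,d)$ with an action by homeomorphisms of a group $G$ with finite symmetric generating set $S$, and $t>0$, let $d_G$ be the largest metric on $\{t\}\times Y$ with $d_G((t,y),(t,y'))\leqslant t\,d(y,y')$ and $d_G((t,y),(t,s.y))\leqslant1$ ($s\in S$). The warped cone $\mathcal{O}_GY$ is the sequence $(\{t\}\times Y,d_G)_{t\in\mathbb{N}}$. Expander. A sequence of finite graphs $\Gamma_n=(V_n,E_n)$ with $|V_n|\to\infty$, uniformly bounded degrees, and Cheeger constants $\min\{|\partial A|/|A| : A\subseteq V_n,\ 1\leqslant|A|\leqslant\frac12|V_n|\}$ bounded below by a positive constant. Coarse notions (always uniform for sequences). $(X_n)_n$, $(Y_n)_n$ are quasi-isometric if there are $f_n\colon X_n\to Y_n$, $L\geqslant1$, $A\geqslant0$ independent of $n$ with $L^{-1}d(x,x')-A\leqslant d(f_n(x),f_n(x'))\leqslant L\,d(x,x')+A$ and $d(y,f_n(X_n))\leqslant A$. A coarse embedding of $(X_n)_n$ into $(Y_n)_n$ is a family $f_n\colon X_n\to Y_n$ such that there are non-decreasing $\eta,\zeta\colon[0,\infty)\to[0,\infty)$, independent of $n$, with $\lim_{r\to\infty}\eta(r)=\infty$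 and $\eta(d(x,x'))\leqslant d(f_n(x),f_n(x'))\leqslant\zeta(d(x,x'))$ for all $n$ and $x,x'\in X_n$. Box space. For a group $G$ generated by a finite set $S$, let $(G_n)_n$ be finite-index normal subgroups such that for every $R\in\mathbb{N}$ there is $n_0$ with $B(1_G,R)\cap\bigcup_{n\geqslant n_0}G_n=\{1_G\}$ ($B(1_G,R)$ the ball in the word metric of $S$). The sequence $(\mathrm{Cay}(G/G_n,S_n))_n$, with $S_n$ the image of $S$, is said to define a box space of $G$. Selberg-type expander. An expander that is the sequence of graphs defining a box space of a finitely generated discrete subgroup of $\mathrm{PSL}_2(\mathbb{R})$ or of $\mathrm{SL}_2(\mathbb{R})$. *)

(* Defs.v *)
From HB Require Import structures.
From mathcomp Require Import all_boot all_order all_algebra all_fingroup.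
From mathcomp Require Import all_classical all_reals all_analysis.
From Stdlib Require Import Relation_Operators.

Set Implicit Arguments.
Unset Strict Implicit.
Unset Printing Implicit Defensive.

Import Order.TTheory GRing.Theory Num.Theory.
Import numFieldNormedType.Exports.
Local Open Scope classical_set_scope.
Local Open Scope ring_scope.
Local Open Scope quotient_scope.

Section Subgroups.
Variable T : groupType.
Implicit Types (H G N S : set T).
Local Open Scope group_scope.

Definition subgroup H : Prop :=
  [/\ H 1, forall x y, H x -> H y -> H (x * y) & forall x, H x -> H x^-1].

Definition gen_subgroup S : set T := smallest subgroup S.

Definition normal_in N G : Prop :=
  [/\ subgroup N, N `<=` G & forall g x, G g -> N x -> N (g^-1 * x * g)].

Definition lcoset_set N (g : T) : set T := [set x | N (g^-1 * x)].

Definition coset_space G N : set (set T) := [set lcoset_set N g | g in G].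

Definition word_ball S (r : nat) : set T :=
  [set g | exists w : seq T,
     [/\ (size w <= r)%N, forall x, x \in w -> S x \/ S x^-1
       & g = \prod_(x <- w) x]].

End Subgroups.

Record sgraph := SGraph {
  vertex :> finType;
  adj : rel vertex;
  adj_sym : symmetric adj;
  adj_irr : irreflexive adj }.

Section Graphs.
Variable R : realType.

(* The infimum is over a set of natural numbers, hence a minimum, as soon as
   [x] and [y] are connected; it is the junk value 0 otherwise. A graph with
   positive Cheeger constant is connected. *)
Definition gdist (X : sgraph) (x y : X) : R :=
  inf [set (size p)%:R | p in [set p : seq X | path (@adj X) x p /\ last x p = y]].

Definition edge_boundary (X : sgraph) (A : {set X}) : {set X * X} :=
  [set e : X * X | [&& e.1 \in A, e.2 \notin A & adj e.1 e.2]].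

(* A minimum over a finite set; it is +oo for a graph with at most one
   vertex. *)
Definition cheeger (X : sgraph) : \bar R :=
  ereal_inf [set (#|edge_boundary A|%:R / #|A|%:R)%:E |
             A in [set A : {set X} | (1 <= #|A|)%N /\ (2 * #|A| <= #|X|)%N]].

Definition expander (X : nat -> sgraph) : Prop :=
  [/\ (fun n => #|X n|) @ \oo --> \oo,
      exists D : nat, forall n (x : X n), (#|[set y | adj x y]%SET| <= D)%N
    & exists2 c : R, 0 < c & forall n, (c%:E <= cheeger (X n))%E].

End Graphs.

Section Coarse.
Variable R : realType.

Definition is_metric (X : Type) (d : X -> X -> R) : Prop :=
  [/\ forall x y, d x y = 0 <-> x = y,
      forall x y, d x y = d y x
    & forall x y z, d x z <= d x y + d y z].

Definition quasi_isometric (X Y : nat -> Type)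
    (dX : forall n, X n -> X n -> R) (dY : forall n, Y n -> Y n -> R) : Prop :=
  exists (f : forall n, X n -> Y n) (L A : R),
    [/\ 1 <= L, 0 <= A,
        forall n x x', L^-1 * dX n x x' - A <= dY n (f n x) (f n x')
                       <= L * dX n x x' + A
      & forall n y,
          (ereal_inf [set (dY n y z)%:E | z in range (f n)] <= A%:E)%E].

(* [eta] and [zeta] are functions on [0, +oo[; their values at negative
   arguments are irrelevant. *)
Definition coarsely_embeds (X Y : nat -> Type)
    (dX : forall n, X n -> X n -> R) (dY : forall n, Y n -> Y n -> R) : Prop :=
  exists (f : forall n, X n -> Y n) (eta zeta : R -> R),
    [/\ (forall r, 0 <= r -> 0 <= eta r) /\ (forall r, 0 <= r -> 0 <= zeta r),
        (forall r s, 0 <= r -> r <= s -> eta r <= eta s) /\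
        (forall r s, 0 <= r -> r <= s -> zeta r <= zeta s),
        eta @ +oo --> +oo
      & forall n x x', eta (dX n x x') <= dY n (f n x) (f n x')
                       <= zeta (dX n x x')].

End Coarse.

Section BoxSpaces.
Variable T : groupType.
Implicit Types (G N S : set T).
Local Open Scope group_scope.

(* [X] is, up to a graph isomorphism [phi], the Cayley graph of the quotient
   of [G] by [N] with respect to the image of [S]: the vertices are the cosets
   [g N], and [g N] is joined to [g s N] for [s] in [S], loops being
   discarded. *)
Definition is_cayley_quotient G N S (X : sgraph) : Prop :=
  exists2 phi : X -> set T, set_bij [set: X] (coset_space G N) phi &
    forall x y : X, adj x y <->
      x <> y /\ exists g s,
        [/\ G g, S s &
            (phi x = lcoset_set N g /\ phi y = lcoset_set N (g * s)) \/
            (phi y = lcoset_set N g /\ phi x = lcoset_set N (g * s))].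

(* In particular [G] is finitely generated. *)
Definition box_space G (X : nat -> sgraph) : Prop :=
  exists (S : set T) (N : nat -> set T),
    [/\ finite_set S /\ gen_subgroup S = G,
        forall n, normal_in (N n) G /\ finite_set (coset_space G (N n)),
        forall r : nat, exists n0 : nat,
          word_ball S r `&` \bigcup_(n in [set n | (n0 <= n)%N]) N n = [set 1]
      & forall n, is_cayley_quotient G (N n) S (X n)].

End BoxSpaces.

Section SL2.
Variable K : comUnitRingType.

Record SL2 := MkSL2 { sl2val :> 'M[K]_2; _ : \det sl2val == 1 }.

HB.instance Definition _ := [isSub for sl2val].
HB.instance Definition _ := [Choice of SL2 by <:].

Lemma det_sl2 (A : SL2) : \det A = 1. Proof. by case: A => A /= /eqP. Qed.

Lemma sl2_unit (A : SL2) : (sl2val A) \in unitmx.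
Proof. by rewrite unitmxE det_sl2 unitr1. Qed.

Lemma sl2_one_subproof : \det (1%:M : 'M[K]_2) == 1.
Proof. by rewrite det1. Qed.
Lemma sl2_mul_subproof (A B : SL2) : \det (A *m B) == 1.
Proof. by rewrite det_mulmx !det_sl2 mulr1. Qed.
Lemma sl2_inv_subproof (A : SL2) : \det (invmx A) == 1.
Proof. by rewrite det_inv det_sl2 invr1. Qed.

Definition sl2_one := MkSL2 sl2_one_subproof.
Definition sl2_mul A B := MkSL2 (sl2_mul_subproof A B).
Definition sl2_inv A := MkSL2 (sl2_inv_subproof A).

Lemma sl2_mulA : associative sl2_mul.
Proof. by move=> A B C; apply/val_inj; rewrite /= mulmxA. Qed.
Lemma sl2_mul1 : left_id sl2_one sl2_mul.
Proof. by move=> A; apply/val_inj; rewrite /= mul1mx. Qed.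
Lemma sl2_1mul : right_id sl2_one sl2_mul.
Proof. by move=> A; apply/val_inj; rewrite /= mulmx1. Qed.
Lemma sl2_mulV : left_inverse sl2_one sl2_inv sl2_mul.
Proof. by move=> A; apply/val_inj; rewrite /= mulVmx // sl2_unit. Qed.
Lemma sl2_Vmul : right_inverse sl2_one sl2_inv sl2_mul.
Proof. by move=> A; apply/val_inj; rewrite /= mulmxV // sl2_unit. Qed.

HB.instance Definition _ :=
  isGroup.Build SL2 sl2_mulA sl2_mul1 sl2_1mul sl2_mulV sl2_Vmul.

Definition mx2 (a b c d : K) : 'M[K]_2 :=
  \matrix_(i, j) if i == 0 then (if j == 0 then a else b)
                 else (if j == 0 then c else d).

Lemma det_mx2 a b c d : \det (mx2 a b c d) = a * d - b * c.
Proof.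
rewrite (expand_det_row _ 0) big_ord_recl big_ord1 /cofactor !det_mx11 !mxE /=.
by rewrite expr0 expr1 mul1r mulN1r mulrN.
Qed.

Lemma upper_subproof (k : K) : \det (mx2 1 k 0 1) == 1.
Proof. by rewrite det_mx2 mulr0 subr0 mulr1. Qed.
Lemma lower_subproof (k : K) : \det (mx2 1 0 k 1) == 1.
Proof. by rewrite det_mx2 mul0r subr0 mulr1. Qed.

Definition upper (k : K) : SL2 := MkSL2 (upper_subproof k).
Definition lower (k : K) : SL2 := MkSL2 (lower_subproof k).

Definition pm_eq (A B : SL2) : bool :=
  (sl2val A == sl2val B) || (sl2val A == - sl2val B).

Lemma pm_eq_refl : reflexive pm_eq.
Proof. by move=> A; rewrite /pm_eq eqxx. Qed.
Lemma pm_eq_sym : symmetric pm_eq.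
Proof.
by move=> A B; rewrite /pm_eq eq_sym -eqr_oppLR [- _ == _]eq_sym.
Qed.
Lemma pm_eq_trans : transitive pm_eq.
Proof.
move=> B A C /orP[]/eqP AB /orP[]/eqP BC; rewrite /pm_eq AB BC ?opprK eqxx //=;
by rewrite orbT.
Qed.

Canonical pm_equiv := EquivRel pm_eq pm_eq_refl pm_eq_sym pm_eq_trans.

Lemma pm_eq_mul A B A' B' :
  pm_eq A A' -> pm_eq B B' -> pm_eq (A * B)%g (A' * B')%g.
Proof.
rewrite /pm_eq /= => /orP[]/eqP-> /orP[]/eqP->;
by rewrite ?mulmxN ?mulNmx ?opprK eqxx ?orbT.
Qed.

Lemma pm_eq_inv A A' : pm_eq A A' -> pm_eq A^-1%g A'^-1%g.
Proof.
move=> e; have : pm_eq (A'^-1 * A * A^-1)%g (A'^-1 * A' * A^-1)%g.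
  by apply: pm_eq_mul (pm_eq_refl _); apply: pm_eq_mul (pm_eq_refl _) e.
by rewrite mulgK mulVg mul1g pm_eq_sym.
Qed.

End SL2.

HB.instance Definition _ (R : realType) :=
  Topological.copy (SL2 R) (initial_topology (@sl2val R)).

Section PSL2.
Variable R : realType.

Definition PSL2 : Type := quotient_topology {eq_quot (pm_equiv R)}.

HB.instance Definition _ := Quotient.on PSL2.
HB.instance Definition _ := Choice.on PSL2.
HB.instance Definition _ := Topological.on PSL2.

Definition psl2_pi (A : SL2 R) : PSL2 := \pi_({eq_quot (pm_equiv R)}) A.
Definition psl2_repr (x : PSL2) : SL2 R := generic_quotient.repr (x : {eq_quot (pm_equiv R)}).

Lemma psl2_reprK : cancel psl2_repr psl2_pi. Proof. exact: reprK. Qed.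
Lemma psl2_pi_eq A B : pm_eq A B -> psl2_pi A = psl2_pi B.
Proof. by move=> e; apply/eqmodP. Qed.
Lemma psl2_repr_pi A : pm_eq (psl2_repr (psl2_pi A)) A.
Proof. by apply/eqmodP; exact: reprK. Qed.

Definition psl2_one : PSL2 := psl2_pi 1%g.
Definition psl2_mul (x y : PSL2) : PSL2 := psl2_pi (psl2_repr x * psl2_repr y)%g.
Definition psl2_inv (x : PSL2) : PSL2 := psl2_pi (psl2_repr x)^-1%g.

Lemma psl2_piM A B : psl2_pi (A * B)%g = psl2_mul (psl2_pi A) (psl2_pi B).
Proof.
by apply/esym/psl2_pi_eq; apply: pm_eq_mul; apply: psl2_repr_pi.
Qed.
Lemma psl2_piV A : psl2_pi A^-1%g = psl2_inv (psl2_pi A).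
Proof. by apply/esym/psl2_pi_eq; apply: pm_eq_inv; apply: psl2_repr_pi. Qed.

Lemma psl2_mulA : associative psl2_mul.
Proof.
move=> x y z; rewrite -[x]psl2_reprK -[y]psl2_reprK -[z]psl2_reprK.
by rewrite -!psl2_piM mulgA.
Qed.
Lemma psl2_mul1 : left_id psl2_one psl2_mul.
Proof. by move=> x; rewrite -[x]psl2_reprK -psl2_piM mul1g. Qed.
Lemma psl2_1mul : right_id psl2_one psl2_mul.
Proof. by move=> x; rewrite -[x]psl2_reprK -psl2_piM mulg1. Qed.
Lemma psl2_mulV : left_inverse psl2_one psl2_inv psl2_mul.
Proof. by move=> x; rewrite -[x]psl2_reprK -psl2_piV -psl2_piM mulVg. Qed.
Lemma psl2_Vmul : right_inverse psl2_one psl2_inv psl2_mul.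
Proof. by move=> x; rewrite -[x]psl2_reprK -psl2_piV -psl2_piM mulgV. Qed.

HB.instance Definition _ :=
  isGroup.Build PSL2 psl2_mulA psl2_mul1 psl2_1mul psl2_mulV psl2_Vmul.

Definition discrete_subset (T : topologicalType) (A : set T) : Prop :=
  A `<=` isolated A.

Definition selberg_type (X : nat -> sgraph) : Prop :=
  expander R X /\
  ((exists G : set PSL2,
      [/\ subgroup G, discrete_subset G & box_space G X]) \/
   (exists G : set (SL2 R),
      [/\ subgroup G, discrete_subset G & box_space G X])).

End PSL2.

Section WarpedCone.
Variables (R : realType) (Y : Type) (d : Y -> Y -> R).
Variables (T : groupType) (act : T -> Y -> Y) (S : set T).

Definition warped_admissible (t : R) (rho : Y -> Y -> R) : Prop :=
  [/\ is_metric rho, forall y y', rho y y' <= t * d y y'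
    & forall s y, S s -> rho y (act s y) <= 1].

(* The largest admissible metric is the pointwise supremum of all of them. *)
Definition warped_dist (t : R) (y y' : Y) : R :=
  sup [set rho y y' | rho in warped_admissible t].

(* The n-th term has parameter t = n + 1, so that t runs over the positive
   integers; the slice {t} x Y is identified with Y. *)
Definition warped_cone (n : nat) : Y -> Y -> R := warped_dist n.+1%:R.

End WarpedCone.

Section Origami.
Variables (R : realType) (m : nat) (sigma tau : 'S_m).

Definition usquare : Type := ({i01 R} * {i01 R})%type.
HB.instance Definition _ := Choice.on usquare.

Definition squares : Type := ('I_m * usquare)%type.
HB.instance Definition _ := Choice.on squares.

Inductive glue : squares -> squares -> Prop :=
| glue_left_right i (y : {i01 R}) :
    glue (i, (0%:i01, y)) (sigma i, (1%:i01, y))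
| glue_top_bottom i (x : {i01 R}) :
    glue (i, (x, 1%:i01)) (tau i, (x, 0%:i01)).

Definition glued (p q : squares) : bool := `[< clos_refl_sym_trans _ glue p q >].

Lemma glued_refl : reflexive glued.
Proof. by move=> p; apply/asboolP; exact: rst_refl. Qed.
Lemma glued_sym : symmetric glued.
Proof. by move=> p q; apply/asboolP/asboolP; exact: rst_sym. Qed.
Lemma glued_trans : transitive glued.
Proof. by move=> q p r /asboolP pq /asboolP; move/(rst_trans _ _ _ _ _ pq)/asboolP. Qed.

Canonical glued_equiv := EquivRel glued glued_refl glued_sym glued_trans.

Definition origami : Type := {eq_quot glued_equiv}.

Definition opt (i : 'I_m) (p : usquare) : origami :=
  \pi_({eq_quot glued_equiv}) (i, p).

Definition eucl_dist (p q : usquare) : R :=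
  Num.sqrt ((p.1%:num - q.1%:num) ^+ 2 + (p.2%:num - q.2%:num) ^+ 2).

(* [(i, (p, q))] stands for the straight segment from [p] to [q] in the
   [i]-th square; the length metric is the infimum of the lengths of the
   broken lines made of finitely many such segments. *)
Fixpoint broken_line (x : origami) (s : seq ('I_m * (usquare * usquare)))
    (y : origami) : Prop :=
  if s is (i, (p, q)) :: s' then x = opt i p /\ broken_line (opt i q) s' y
  else x = y.

Definition broken_line_length (s : seq ('I_m * (usquare * usquare))) : R :=
  \sum_(c <- s) eucl_dist c.2.1 c.2.2.

Definition origami_dist (x y : origami) : R :=
  inf [set broken_line_length s | s in [set s | broken_line x s y]].

Definition perm_powz (s : 'S_m) (j : int) : 'S_m :=
  match j with Posz n => (s ^+ n)%g | Negz n => (s ^- n.+1)%g end.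

Lemma frac_ge0 (x : R) : 0 <= x - (Num.floor x)%:~R.
Proof. by rewrite subr_ge0 Num.Theory.floor_le. Qed.
Lemma frac_le1 (x : R) : x - (Num.floor x)%:~R <= 1.
Proof. by rewrite lerBlDl -[X in _ + X]/(1%:~R) -intrD ltW // floorD1_gt. Qed.
Definition frac_part (x : R) : {i01 R} := Itv01 (frac_ge0 x) (frac_le1 x).

(* Of the intervals [j, j + 1] containing a coordinate we choose the one with
   [j] its floor; at integral coordinates the other choice gives the same
   point, because of the gluing. *)
Definition hor_line (i : 'I_m) (x : R) (y : {i01 R}) : origami :=
  opt (perm_powz sigma (- Num.floor x) i) (frac_part x, y).

Definition ver_line (i : 'I_m) (x : {i01 R}) (y : R) : origami :=
  opt (perm_powz tau (Num.floor y) i) (x, frac_part y).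

Definition multi_twist_group (k : nat) : set (SL2 int) :=
  gen_subgroup [set upper k%:Z; lower k%:Z].

(* Since the two generators generate the group, an action of it is determined
   by its values on them. Here upper k maps the column (x, y) to (x + k y, y)
   and lower k maps it to (x, k x + y). *)
Record multi_twist_action (k : nat) (act : SL2 int -> origami -> origami) :
    Prop := {
  mt_act1 : forall p, act 1%g p = p;
  mt_actM : forall g h, multi_twist_group k g -> multi_twist_group k h ->
    forall p, act (g * h)%g p = act g (act h p);
  mt_upper : forall i (x y : {i01 R}),
    act (upper k%:Z) (opt i (x, y)) = hor_line i (x%:num + k%:R * y%:num) y;
  mt_lower : forall i (x y : {i01 R}),
    act (lower k%:Z) (opt i (x, y)) = ver_line i x (k%:R * x%:num + y%:num) }.

End Origami.

Definition finite_symmetric_generating (T : groupType) (G S : set T) : Prop :=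
  [/\ finite_set S, forall s, S s -> S s^-1%g & gen_subgroup S = G].

(* Main.v *)
(* Near a corner of a square the points with coordinates (u / t, v / t), where u
   and v are integers that are small compared with t, are moved by the two
   twists linearly, as by the two elementary matrices.  At scale t these points
   thus form a piece of the lattice Z^2 in which distances are measured as in
   the semidirect product of Z^2 with the free group: as the commutator of a
   shear with a translation by W is a translation by k W, the box [0, W^2)^2 has
   warped diameter O(W).  On the other hand a warped ball of bounded radius
   contains a bounded number of points of the box, because the origami surface
   maps onto the torus by a map that does not increase distances and carries the
   action to the linear one.

   Composing with the coarse maps and lifting from the box space to the discrete
   group (possible for large n) gives uniformly Lipschitz maps from the grids
   W^2 x W^2 to an orbit in the hyperbolic plane with diameter O(W) and uniformly
   bounded fibres.  Some vertical line {Re z = a} is crossed by every row or by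
   every column of the grid, so at least W^2 grid points lie at bounded distance
   from it; but within distance O(W) of the base point there are only O(W) orbit
   points near a geodesic, a contradiction for large W. *)
Require Import Defs.
From mathcomp Require Import all_boot all_order all_algebra all_fingroup.
From mathcomp Require Import all_classical all_reals all_analysis.
From mathcomp Require Import ring lra zify.
From Stdlib Require Import Relation_Operators.

Set Implicit Arguments.
Unset Strict Implicit.
Unset Printing Implicit Defensive.

Import Order.TTheory GRing.Theory Num.Theory.
Import numFieldNormedType.Exports.

(** * Large thin grids cannot lie in the hyperbolic plane *)

Section Crossing.
Local Open Scope ring_scope.

Lemma card_le_fibers (I : finType) (U : eqType) (f : I -> U) (s : seq U)
    (C : nat) (A : {set I}) :
  {in A, forall i, f i \in s} ->
  (forall u, #|[set i in A | f i == u]%SET| <= C)%N ->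
  (#|A| <= size s * C)%N.
Proof.
elim: s A => [|u s IH] A fA fib.
  by rewrite mul0n leqn0 cards_eq0; apply/eqP/setP => i; rewrite inE;
    apply/negP => /fA.
pose B := [set i in A | f i == u]%SET.
rewrite -(cardsID B A) mulSn leq_add //.
  by apply: leq_trans (subset_leq_card (subsetIr _ _)) (fib u).
apply: IH => [i|v].
  rewrite !inE => /andP[+ iA]; rewrite iA /= => /negbTE fu.
  by have := fA i iA; rewrite inE fu.
apply: leq_trans (fib v); apply: subset_leq_card; apply/fintype.subsetP => i.
by rewrite !inE => /andP[/andP[_ ->] ->].
Qed.

Lemma card_ge_onto (I J : finType) (f : I -> J) (A : {set I}) :
  (forall u, exists2 p, p \in A & f p = u) -> (#|J| <= #|A|)%N.
Proof.
move=> fA; apply: leq_trans (leq_imset_card f A); rewrite -cardsT.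
apply: subset_leq_card; apply/fintype.subsetP => u _.
by have [p pA <-] := fA u; apply/imsetP; exists p.
Qed.

Variable R : realType.

Definition neighb (i j : nat) : bool := ((i <= j.+1) && (j <= i.+1))%N.

(** If no two neighbouring indices straddle [a], then being below [a] propagates from index 0 to all
    others. As [neighb] is reflexive, a term equal to [a] already counts as a crossing. *)
Lemma discrete_ivt (M : nat) (z : nat -> R) (a : R) (i j : nat) :
  (i < M)%N -> (j < M)%N -> z i <= a -> a <= z j ->
  exists l l', [/\ (l < M)%N, (l' < M)%N, neighb l l' & z l <= a <= z l'].
Proof.
move=> iM jM zi zj; apply: contrapT => nex.
have no l l' : (l < M)%N -> (l' < M)%N -> neighb l l' -> ~ (z l <= a <= z l').
  by move=> ? ? ? ?; apply: nex; exists l, l'.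
have same l : (l < M)%N -> (z l < a) = (z 0%N < a).
  elim: l => // l IH lM; rewrite -IH; last by lia.
  by apply/idP/idP => h; rewrite ltNge; apply/negP => h';
    [apply: (no l.+1 l)|apply: (no l l.+1)]; rewrite /neighb ?h' ?ltW //; lia.
have zi' : z i < a.
  rewrite lt_neqAle zi andbT; apply/eqP => e; case: (no i i) => //.
    by rewrite /neighb; lia.
  by rewrite e lexx.
by have := same j jM; rewrite -(same i iM) zi' ltNge zj.
Qed.

Definition grid_adj (M : nat) (p q : 'I_M * 'I_M) : bool :=
  (p.1 == q.1) && neighb p.2 q.2 || neighb p.1 q.1 && (p.2 == q.2).

Definition crossing (M : nat) (X : 'I_M * 'I_M -> R) (a : R) :=
  [set p : 'I_M * 'I_M | [exists q, grid_adj p q && (X p <= a <= X q)]]%SET.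

Lemma fin_min (I : finType) (i0 : I) (f : I -> R) :
  exists i, forall j, f i <= f j.
Proof. by case: (arg_minP f (isT : xpredT i0)) => i _ h; exists i => j; exact: h. Qed.

(* Take the row with the smallest maximum and the row with the largest minimum:
   either a common value [a] lies in the range of every row, or some [a]
   separates the two rows and is crossed by every column. *)
Lemma grid_crossing (M : nat) (X : 'I_M * 'I_M -> R) :
  exists a, (M <= #|crossing X a|)%N.
Proof.
case: (posnP M) => [M0|M0]; first by exists 0; rewrite [X in (X <= _)%N]M0.
pose i0 : 'I_M := Ordinal M0.
have /choice[lo loP] (r : 'I_M) : exists c, forall c', X (r, c) <= X (r, c').
  exact: fin_min i0 (fun c => X (r, c)).
have /choice[hi hiP] (r : 'I_M) : exists c, forall c', X (r, c') <= X (r, c).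
  have [c h] := fin_min i0 (fun c => - X (r, c)).
  by exists c => c'; rewrite -lerN2; exact: h.
have [r1 r1P] := fin_min i0 (fun r => X (r, hi r)).
have [r2 r2P] := fin_min i0 (fun r => - X (r, lo r)).
have ivt (f : 'I_M -> 'I_M * 'I_M) a i j : X (f i) <= a -> a <= X (f j) ->
    exists l l' : 'I_M, neighb l l' /\ X (f l) <= a <= X (f l').
  move=> h1 h2; pose z (n : nat) := if insub n is Some o then X (f o) else 0.
  have zE (o : 'I_M) : z o = X (f o) by rewrite /z valK.
  have := @discrete_ivt M z a i j (ltn_ord _) (ltn_ord _).
  rewrite !zE => /(_ h1 h2)[l [l' [lM l'M nb]]].
  by rewrite -[l]/(val (Ordinal lM)) -[l']/(val (Ordinal l'M)) !zE;
    exists (Ordinal lM), (Ordinal l'M).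
case: (lerP (X (r2, lo r2)) (X (r1, hi r1))) => h.
  exists (X (r2, lo r2)).
  rewrite -[X in (X <= _)%N]card_ord; apply: (@card_ge_onto _ _ fst) => r.
  have [||l [l' [nb lP]]] := ivt (fun c => (r, c)) (X (r2, lo r2)) (lo r) (hi r).
  - by rewrite -lerN2; exact: r2P.
  - exact: le_trans h (r1P _).
  - exists (r, l) => //; rewrite inE; apply/existsP.
    by exists (r, l'); rewrite /grid_adj /= eqxx nb.
exists (X (r1, hi r1)).
rewrite -[X in (X <= _)%N]card_ord; apply: (@card_ge_onto _ _ snd) => c.
have [||l [l' [nb lP]]] := ivt (fun r => (r, c)) (X (r1, hi r1)) r1 r2.
- exact: hiP.
- exact/ltW/(lt_le_trans h).
- exists (l, c) => //; rewrite inE; apply/existsP.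
  by exists (l', c); rewrite /grid_adj /= eqxx nb orbT.
Qed.

End Crossing.

(* [G] contains no arbitrarily large uniformly Lipschitz grids of side [W ^ 2]
   and diameter [O(W)] with uniformly bounded fibres. *)
Definition grid_free (T : groupType) (G : set T) : Prop :=
  forall (F : seq T) (C0 C : nat), exists W0 : nat, forall W, (W0 <= W)%N ->
  ~ exists w : 'I_(W ^ 2) * 'I_(W ^ 2) -> T,
    [/\ forall p q, G ((w p)^-1 * w q)%g,
        forall p, word_ball [set` F] (C * W) (w p),
        forall p q, grid_adj p q -> ((w p)^-1 * w q)%g \in F
      & forall g, (#|[set p | w p == g]%SET| <= C0)%N].

(** * Orbits near a vertical geodesic of the upper half-plane *)

Section HyperbolicCut.
Local Open Scope classical_set_scope.
Local Open Scope ring_scope.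

Variable R : realType.

Lemma geometric_scale (K z : R) (N : nat) : 1 <= K -> 1 <= z -> z <= K ^+ N ->
  exists2 j, (j <= N)%N & K ^+ j <= z <= K ^+ j.+1.
Proof.
move=> K1 z1; elim: N => [|N IH] zN.
  by exists 0%N => //; rewrite z1 (le_trans zN) // expr0 expr1.
case: (lerP z (K ^+ N)) => [/IH[j jN jP]|h]; first by exists j => //; exact: leqW.
by exists N => //; rewrite (ltW h).
Qed.

(* [2 cosh d(x + iy, x' + iy')] in the upper half-plane. *)
Definition hyp2cosh (x y x' y' : R) : R :=
  ((x - x') ^+ 2 + y ^+ 2 + y' ^+ 2) / (y * y').

Lemma hyp2coshC x y x' y' : hyp2cosh x y x' y' = hyp2cosh x' y' x y.
Proof. by rewrite /hyp2cosh (mulrC y); congr (_ / _); ring. Qed.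

Lemma hyp2cosh_le x y x' y' K : 0 < y -> 0 < y' ->
  (hyp2cosh x y x' y' <= K) =
  ((x - x') ^+ 2 + y ^+ 2 + y' ^+ 2 <= K * (y * y')).
Proof. by move=> y0 y'0; rewrite /hyp2cosh ler_pdivrMr ?mulr_gt0. Qed.

(** Dropping two of the three squares leaves [y'^2 <= K y y']: a bounded displacement changes the
    height by a bounded factor. *)
Lemma hyp2cosh_im x y x' y' K : 0 < y -> 0 < y' ->
  hyp2cosh x y x' y' <= K -> y' <= K * y.
Proof.
move=> y0 y'0; rewrite hyp2cosh_le // => h.
rewrite -(ler_pM2r y'0); have := sqr_ge0 (x - x'); nra.
Qed.

(** As the height grows by a factor at most [K], one has [(x - x')^2 <= K y y' <= (K y)^2]. The
    conclusion puts the point into a cone around the vertical line at [a], which is a bounded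
    neighbourhood of this geodesic. *)
Lemma hyp2cosh_cross x y x' y' a K : 0 <= K -> 0 < y -> 0 < y' ->
  hyp2cosh x y x' y' <= K -> x <= a <= x' -> `|x - a| <= K * y.
Proof.
move=> K0 y0 y'0 h /andP[xa ax'].
have yy' := hyp2cosh_im y0 y'0 h.
rewrite distrC ger0_norm ?subr_ge0 // (@le_trans _ _ (x' - x)) //; first lra.
rewrite -ler_sqr ?nnegrE ?subr_ge0 ?mulr_ge0 //; [|lra|exact: ltW].
move: h; rewrite hyp2cosh_le // => h.
have : K * (y * y') <= K * (y * (K * y)) by rewrite !ler_wpM2l // ltW.
nra.
Qed.

(** Dilations are isometries, so the part of the cone with heights in [[c, K c]] has a diameter
    independent of [c]. The real parts differ by at most [2 K^2 c], which gives [4 K^4]; the two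
    heights give [2 K^2]. *)
Lemma hyp2cosh_strip x y x' y' a c K : 0 < c -> 0 <= K ->
  c <= y <= K * c -> c <= y' <= K * c ->
  `|x - a| <= K * y -> `|x' - a| <= K * y' ->
  hyp2cosh x y x' y' <= 4 * K ^+ 4 + 2 * K ^+ 2.
Proof.
move=> c0 K0 /andP[cy yc] /andP[cy' yc'] xa x'a.
have y0 : 0 < y by lra.
have y'0 : 0 < y' by lra.
rewrite hyp2cosh_le //.
have Kc : 0 <= K * c by lra.
have b1 : K * y <= K * (K * c) by rewrite ler_wpM2l.
have b2 : K * y' <= K * (K * c) by rewrite ler_wpM2l.
have : `|x - x'| <= 2 * (K * (K * c)).
  rewrite (_ : x - x' = (x - a) - (x' - a)); last by ring.
  by apply: le_trans (ler_normB _ _) _; lra.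
rewrite -ler_sqr ?nnegrE //; last by rewrite !mulr_ge0 // ltW.
rewrite real_normK ?num_real // => b3.
have b4 : y ^+ 2 <= (K * c) ^+ 2 by rewrite ler_sqr ?nnegrE // ltW.
have b5 : y' ^+ 2 <= (K * c) ^+ 2 by rewrite ler_sqr ?nnegrE // ltW.
apply: (@le_trans _ _ ((4 * K ^+ 4 + 2 * K ^+ 2) * (c * c))).
  rewrite (_ : _ * (c * c) = (2 * (K * (K * c))) ^+ 2 + (K * c) ^+ 2 + (K * c) ^+ 2);
    last by ring.
  by rewrite !lerD.
have K2 : 0 <= K ^+ 2 by exact: sqr_ge0.
have K4 : 0 <= K ^+ 4 by rewrite exprn_ge0.
by apply: ler_wpM2l; [lra|apply: ler_pM => //; exact: ltW].
Qed.

Variables (T : groupType) (X Y : T -> R) (G : set T).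

Definition orbit2cosh (g h : T) : R := hyp2cosh (X g) (Y g) (X h) (Y h).

Hypothesis Y_gt0 : forall g, 0 < Y g.
Hypothesis orbit2coshM :
  forall f g h, orbit2cosh (f * g)%g (f * h)%g = orbit2cosh g h.
Hypothesis G_proper :
  forall r : R, exists s : seq T, forall g, G g -> orbit2cosh 1%g g <= r -> g \in s.

Lemma orbit2coshE g h : orbit2cosh g h = orbit2cosh 1%g (g^-1 * h)%g.
Proof. by rewrite -[RHS](orbit2coshM g) mulg1 mulVKg. Qed.

Lemma orbit2coshV g : orbit2cosh 1%g g^-1%g = orbit2cosh 1%g g.
Proof. by rewrite -[LHS](orbit2coshM g) mulg1 mulgV /orbit2cosh hyp2coshC. Qed.

Lemma word_im (F : seq T) (K : R) (N : nat) (g : T) : 1 <= K ->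
  (forall f, f \in F -> orbit2cosh 1%g f <= K) ->
  word_ball [set` F] N g -> Y g <= K ^+ N * Y 1%g /\ Y 1%g <= K ^+ N * Y g.
Proof.
move=> K1 FK [w [wN wF ->]]; have K0 : 0 <= K by lra.
suff [h1 h2] : Y (\prod_(x <- w) x)%g <= K ^+ size w * Y 1%g /\
    Y 1%g <= K ^+ size w * Y (\prod_(x <- w) x)%g.
  have pw : K ^+ size w <= K ^+ N by exact: ler_weXn2l.
  by split; [apply: le_trans h1 _|apply: le_trans h2 _]; rewrite ler_wpM2r // ltW.
elim/last_ind: w {wN} wF => [|w x IH] wF.
  by rewrite big_nil expr0 mul1r.
have [|h1 h2] := IH; first by move=> y yw; apply: wF; rewrite mem_rcons inE yw orbT.
have xK : orbit2cosh 1%g x <= K.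
  have [|/FK//|/FK] := wF x; first by rewrite mem_rcons inE eqxx.
  by rewrite orbit2coshV.
rewrite -cats1 big_cat /= big_seq1.
set g0 := (\prod_(y <- w) y)%g in h1 h2 *.
have hK : orbit2cosh g0 (g0 * x)%g <= K by rewrite -[X in orbit2cosh X _]mulg1 orbit2coshM.
have hK' : orbit2cosh (g0 * x)%g g0 <= K by rewrite /orbit2cosh hyp2coshC.
have /= y1 := hyp2cosh_im (Y_gt0 _) (Y_gt0 _) hK.
have /= y2 := hyp2cosh_im (Y_gt0 _) (Y_gt0 _) hK'.
rewrite size_cat /= addn1 exprS; split.
  by apply: le_trans y1 _; rewrite -mulrA ler_wpM2l.
apply: le_trans h2 _; rewrite (mulrC K) -mulrA ler_wpM2l // exprn_ge0 //.
Qed.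

(** The grid points that cross a suitable vertical line lie in a cone around it. Their heights fall
    into [2 C W + 1] layers of ratio [K], and each layer holds boundedly many grid points, by
    properness and the fibre bound. This linear count contradicts the at least [W ^ 2] crossings. *)
Lemma proper_grid_free : grid_free G.
Proof.
move=> F C0 C.
have [K [K1 FK]] : exists K : R, 1 <= K /\ forall f, f \in F -> orbit2cosh 1%g f <= K.
  elim: F => [|f F [K [K1 FK]]]; first by exists 1.
  exists (Num.max K (orbit2cosh 1%g f)); split; first by rewrite le_max K1.
  move=> g; rewrite inE => /orP[/eqP->|/FK h]; rewrite le_max ?lexx ?orbT //.
  by rewrite h.
have K0 : 0 <= K by lra.
(* The radius is the diameter bound of one layer from [hyp2cosh_strip]. *)
have [s sP] := G_proper (4 * K ^+ 4 + 2 * K ^+ 2).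
pose B := (size s * C0)%N.
(* Beyond this threshold [(2 C W + 1) B <= (2 C + 1) B W < W ^ 2]. *)
exists ((2 * C + 1) * B).+1 => W WB [w [wG wD wF wC]].
have [a] := grid_crossing (fun p => X (w p)).
set A := crossing _ _.
pose D := (C * W)%N.
have AK p : p \in A -> `|X (w p) - a| <= K * Y (w p).
  rewrite inE => /existsP[q /andP[pq]].
  apply: (@hyp2cosh_cross _ _ _ (Y (w q))) => //.
  by rewrite -/(orbit2cosh _ _) orbit2coshE; apply: FK; exact: wF.
(* By [word_im] the height differs from [Y 1] by a factor at most [K ^+ D] either way; multiplying
   by [K ^+ D] makes the layer index a natural number up to [2 * D]. *)
have /choice[j jP] p : exists j, (j <= 2 * D)%N /\
    K ^+ j <= K ^+ D * Y (w p) / Y 1%g <= K ^+ j.+1.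
  have [h1 h2] := word_im K1 FK (wD p).
  have [|||j j1 j2] := @geometric_scale K (K ^+ D * Y (w p) / Y 1%g) (2 * D).
  - by [].
  - by rewrite ler_pdivlMr // mul1r.
  - by rewrite ler_pdivrMr // mulSn mul1n exprD -mulrA ler_wpM2l // exprn_ge0.
  - by exists j.
have : (#|A| <= size (iota 0 (2 * D).+1) * B)%N.
  apply: (@card_le_fibers _ _ j) => [p pA|u].
    by rewrite mem_iota /= add0n ltnS; have [] := jP p.
  set Au := [set i in A | _]%SET.
  have [->|[p0 p0A]] := set_0Vmem Au; first by rewrite cards0.
  (* Seen from one fixed point [p0] of the layer, every other point of the layer is a bounded
     displacement away, so the quotients lie in the finite list [s]. *)
  apply: (@card_le_fibers _ _ (fun p => (w p0)^-1 * w p)%g) => [p pA|g].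
    apply: sP; first exact: wG.
    rewrite -orbit2coshE.
    move: p0A pA; rewrite ![_ \in Au]inE => /andP[p0A /eqP e0] /andP[pA /eqP e1].
    have scale q : q \in A -> j q = u ->
        K ^+ u * Y 1%g / K ^+ D <= Y (w q) <= K * (K ^+ u * Y 1%g / K ^+ D).
      have KD : 0 < K ^+ D by rewrite exprn_gt0 //; lra.
      move=> qA <-; have [_ /andP[b1 b2]] := jP q.
      move: b1 b2; rewrite ler_pdivlMr // ler_pdivrMr // => b1 b2.
      rewrite ler_pdivrMr // [Y (w q) * _]mulrC b1 /=.
      by rewrite mulrA ler_pdivlMr // [Y (w q) * _]mulrC (le_trans b2) // exprS -mulrA.
    apply: (@hyp2cosh_strip _ _ _ _ a (K ^+ u * Y 1%g / K ^+ D)).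
    + by rewrite divr_gt0 ?mulr_gt0 ?exprn_gt0 //; lra.
    + exact: K0.
    + exact: scale.
    + exact: scale.
    + exact: AK.
    + exact: AK.
  apply: leq_trans (wC (w p0 * g)%g); apply: subset_leq_card.
  by apply/fintype.subsetP => p; rewrite !inE => /andP[_ /eqP<-]; rewrite mulKVg.
rewrite size_iota => h1 h2.
have : (W ^ 2 <= (2 * D).+1 * B)%N by exact: leq_trans h1.
rewrite /D => h3.
have W1 : (0 < W)%N by lia.
have : ((2 * (C * W)).+1 * B <= (2 * C + 1) * B * W)%N.
  apply: (@leq_trans ((2 * C + 1) * W * B)%N); last by lia.
  by rewrite leq_mul2r; apply/orP; right; rewrite mulnDl mul1n; nia.
have : ((2 * C + 1) * B * W < W ^ 2)%N by rewrite expnS expn1 ltn_mul2r W1.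
lia.
Qed.

End HyperbolicCut.

(** * Discrete subgroups of SL2 and PSL2 *)

Section MobiusAction.
Local Open Scope classical_set_scope.
Local Open Scope ring_scope.

Lemma mul2x2E (K : comUnitRingType) (A B : 'M[K]_2) i j :
  (A *m B) i j = A i 0 * B 0 j + A i 1 * B 1 j.
Proof.
rewrite mxE !big_ord_recl big_ord0 addr0.
by rewrite (_ : lift ord0 ord0 = 1) //; apply/val_inj.
Qed.

Lemma det2x2E (K : comUnitRingType) (A : 'M[K]_2) :
  \det A = A 0 0 * A 1 1 - A 0 1 * A 1 0.
Proof.
rewrite -det_mx2; congr (\det _); apply/matrixP => i j; rewrite mxE.
by case: i => [[|[]]] //= ?; case: j => [[|[]]] //= ?;
  congr (A _ _); apply/val_inj.
Qed.

Lemma ord2P (l : 'I_2) : l = 0 \/ l = 1.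
Proof. by case: l => [[|[]]] //= ?; [left|right]; apply/val_inj. Qed.

Lemma sl2_ext (K : comUnitRingType) (A B : SL2 K) :
  A 0 0 = B 0 0 -> A 0 1 = B 0 1 -> A 1 0 = B 1 0 -> A 1 1 = B 1 1 -> A = B.
Proof.
move=> h1 h2 h3 h4; apply/val_inj/matrixP => i j /=.
by case: (ord2P i) => ->; case: (ord2P j) => ->.
Qed.

Lemma sl2_det (K : comUnitRingType) (A : SL2 K) :
  A 0 0 * A 1 1 - A 0 1 * A 1 0 = 1.
Proof. by rewrite -det2x2E det_sl2. Qed.

Lemma sl2_mulE (K : comUnitRingType) (A B : SL2 K) i j :
  (A * B)%g i j = A i 0 * B 0 j + A i 1 * B 1 j.
Proof. exact: mul2x2E. Qed.

Lemma sl2_adj_subproof (K : comUnitRingType) (A : SL2 K) :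
  \det (mx2 (A 1 1) (- A 0 1) (- A 1 0) (A 0 0)) == 1.
Proof. by rewrite det_mx2 mulrNN mulrC sl2_det. Qed.

Lemma sl2_invE (K : comUnitRingType) (A : SL2 K) :
  A^-1%g = MkSL2 (sl2_adj_subproof A).
Proof.
apply: (@mulgI _ A); rewrite mulgV; have := sl2_det A => d.
apply: sl2_ext; rewrite sl2_mulE !mxE /=.
- by rewrite mulrN d.
- by rewrite mulrN mulrC addNr.
- by rewrite mulrN mulrC subrr.
- by rewrite mulrN addrC [A 1 1 * _]mulrC [A 1 0 * _]mulrC d.
Qed.

Variable R : realType.

(** With [moeb_re], these are the coordinates of the image of the point i of the upper half-plane
    under the Moebius transformation of [A]. *)
Definition moeb_im (A : SL2 R) : R := (A 1 0 ^+ 2 + A 1 1 ^+ 2)^-1.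

Definition moeb_re (A : SL2 R) : R :=
  (A 0 0 * A 1 0 + A 0 1 * A 1 1) * moeb_im A.

Lemma moeb_den_gt0 (A : SL2 R) : 0 < A 1 0 ^+ 2 + A 1 1 ^+ 2.
Proof.
rewrite lt_neqAle addr_ge0 ?sqr_ge0 // andbT eq_sym.
rewrite paddr_eq0 ?sqr_ge0 // !sqrf_eq0; apply/negP => /andP[/eqP h1 /eqP h2].
by have := sl2_det A; rewrite h1 h2 !mulr0 subr0 => /esym/eqP; rewrite oner_eq0.
Qed.

Lemma moeb_im_gt0 (A : SL2 R) : 0 < moeb_im A.
Proof. by rewrite invr_gt0 moeb_den_gt0. Qed.

Definition sl2_sqnorm (A : SL2 R) : R :=
  A 0 0 ^+ 2 + A 0 1 ^+ 2 + A 1 0 ^+ 2 + A 1 1 ^+ 2.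

(** This expresses the invariance of the hyperbolic distance: the points A.i and AB.i are as far
    apart as i and B.i. It also turns properness of the orbit into boundedness of matrices. *)
Lemma hyp2cosh_moeb (A B : SL2 R) :
  hyp2cosh (moeb_re A) (moeb_im A) (moeb_re (A * B)%g) (moeb_im (A * B)%g) =
  sl2_sqnorm B.
Proof.
have nA := moeb_den_gt0 A; have nAB := moeb_den_gt0 (A * B)%g.
have dA := sl2_det A; have dB := sl2_det B.
rewrite /hyp2cosh /moeb_re /moeb_im /sl2_sqnorm.
move: nA nAB; rewrite !sl2_mulE.
set a := A 0 0 in dA *; set b := A 0 1 in dA *; set c := A 1 0 in dA *; set d := A 1 1 in dA *.
set e := B 0 0 in dB *; set f := B 0 1 in dB *; set g := B 1 0 in dB *; set h := B 1 1 in dB *.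
set n := c ^+ 2 + d ^+ 2; set n' := (c * e + d * g) ^+ 2 + (c * f + d * h) ^+ 2.
move=> n0 n'0.
set re' := (a * e + b * g) * (c * e + d * g) + (a * f + b * h) * (c * f + d * h).
have key : ((a * c + b * d) * n' - re' * n) ^+ 2 + n' ^+ 2 + n ^+ 2 = (e ^+ 2 + f ^+ 2 + g ^+ 2 + h ^+ 2) * (n * n').
  (* Inserting powers of the two determinants, both equal to 1, makes the claim a polynomial
     identity in free entries. *)
  have E : ((a * c + b * d) * n' - re' * n) ^+ 2 + (a * d - b * c) ^+ 2 * n' ^+ 2
      + (a * d - b * c) ^+ 2 * (e * h - f * g) ^+ 2 * n ^+ 2 =
      (a * d - b * c) ^+ 2 * (e ^+ 2 + f ^+ 2 + g ^+ 2 + h ^+ 2) * (n * n').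
    by rewrite /re' /n /n'; ring.
  by move: E; rewrite dA dB expr1n !mul1r.
have -> : (e ^+ 2 + f ^+ 2 + g ^+ 2 + h ^+ 2) =
  (e ^+ 2 + f ^+ 2 + g ^+ 2 + h ^+ 2) * (n * n') / (n * n').
  by rewrite mulfK // mulf_neq0 ?gt_eqF.
rewrite -key; field; by rewrite !gt_eqF.
Qed.

(** Cut the bounded range of each entry into intervals of length [del]. Matrices in the same cell
    satisfy [A^-1 B - 1 = A^-1 (B - A)], which is small, so each of the finitely many cells contains
    at most one matrix of [P]. *)
Lemma sl2_proper_finite (P : SL2 R -> Prop) (eps r : R) : 0 < eps ->
  (forall A B, P A -> P B ->
     (forall i j, `|(A^-1 * B)%g i j - (i == j)%:R| < eps) -> A = B) ->
  (forall A, P A -> sl2_sqnorm A <= r) ->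
  exists s : seq (SL2 R), forall A, P A -> A \in s.
Proof.
move=> eps0 sep bnd.
pose b := `|r| + 1.
have b0 : 0 < b by rewrite ltr_wpDl.
have entry A i j : P A -> `|A i j| <= b.
  move=> /bnd Ar; have : A i j ^+ 2 <= r.
    apply: le_trans Ar; rewrite /sl2_sqnorm.
    have := sqr_ge0 (A 0 0); have := sqr_ge0 (A 0 1).
    have := sqr_ge0 (A 1 0); have := sqr_ge0 (A 1 1).
    by case: (ord2P i) => ->; case: (ord2P j) => ->; lra.
  move=> h; rewrite -ler_sqr ?nnegrE ?(ltW b0) // real_normK ?num_real //.
  apply: le_trans h _; have := ler_norm r; rewrite /b; nra.
(* The entries of an inverse are those of the matrix up to sign and place, hence bounded by [b]; an
   entry of [A^-1 (B - A)] is then at most [2 b del = eps / 2]. *)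
pose del := eps / (4 * b).
have del0 : 0 < del by rewrite divr_gt0 // mulr_gt0.
pose N := Num.bound (b / del).
have bN : b / del < N%:R by apply: archi_boundP; rewrite divr_ge0 // ltW.
pose code (A : SL2 R) := ((Num.floor (A 0 0 / del), Num.floor (A 0 1 / del)),
                          (Num.floor (A 1 0 / del), Num.floor (A 1 1 / del))).
pose Z : set int := [set (n%:Z - N%:Z) | n in `I_(N + N)].
have finZ : finite_set Z by apply: finite_image; exact: finite_II.
have codeZ A i j : P A -> Z (Num.floor (A i j / del)).
  move=> /(entry A i j) h.
  have : `|A i j / del| <= b / del by rewrite normrM [`|del^-1|]ger0_norm ?invr_ge0 ?(ltW del0) // ler_pM2r ?invr_gt0.
  rewrite ler_norml => /andP[h1 h2].
  have f1 : (- N%:Z <= Num.floor (A i j / del))%R.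
    by rewrite floor_ge_int intrN -[N%:Z%:~R]/(N%:R); lra.
  have f2 : (Num.floor (A i j / del) < N%:Z)%R.
    by rewrite floor_lt_int -[N%:Z%:~R]/(N%:R); lra.
  move: (Num.floor _) f1 f2 => z f1 f2.
  exists (absz (z + N%:Z)); first by rewrite /=; lia.
  by lia.
have fin : finite_set [set A | P A].
  have inj : {in [set A | P A] &, injective code}.
    move=> A B; rewrite !inE /= => PA PB [e1 e2 e3 e4].
    have close i j : `|B i j - A i j| <= del.
      have fl x y : Num.floor (x / del) = Num.floor (y / del) -> `|y - x| <= del.
        move=> e; have := floor_itv (x / del); have := floor_itv (y / del).
        rewrite e intrD => /andP[h1 h2] /andP[h3 h4].
        have : `|y / del - x / del| <= 1 by rewrite ler_norml; apply/andP; split; lra.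
        by rewrite -mulrBl normrM [`|del^-1|]ger0_norm ?invr_ge0 ?(ltW del0) // ler_pdivrMr // mul1r.
      by case: (ord2P i) => ->; case: (ord2P j) => ->; exact: fl.
    apply: sep => // i j.
    have -> : (A^-1 * B)%g i j - (i == j)%:R =
       (A^-1)%g i 0 * (B 0 j - A 0 j) + (A^-1)%g i 1 * (B 1 j - A 1 j).
      have : (A^-1 * A)%g i j = (i == j)%:R by rewrite mulVg /= mxE.
      by rewrite !sl2_mulE => <-; ring.
    have invb k l : `|(A^-1)%g k l| <= b.
      by rewrite sl2_invE mxE; do 2!case: ifP => _; rewrite ?normrN; exact: entry.
    apply: (@le_lt_trans _ _ (b * del + b * del)).
      by apply: le_trans (ler_normD _ _) _; rewrite !normrM lerD // ler_pM.
    have -> : b * del = eps / 4 by rewrite /del; field; rewrite gt_eqF.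
    lra.
  rewrite -(eq_finite_set (inj_card_eq inj)).
  apply: (@sub_finite_set _ _ ((Z `*` Z) `*` (Z `*` Z))).
    by move=> _ [A PA <-]; rewrite /code; split; split; apply: codeZ.
  by apply: finite_setX; apply: finite_setX.
have /finite_seqP[s sE] := fin.
by exists s => A PA; have : [set` s] A by rewrite -sE.
Qed.

Lemma nbhs1_sl2 (V : set (SL2 R)) : nbhs (1%g : SL2 R) V ->
  exists2 eps : R, 0 < eps &
    forall A : SL2 R, (forall i j, `|A i j - (i == j)%:R| < eps) -> V A.
Proof.
rewrite nbhsE => -[U [oU U1] UV]; case: oU => W oW WU.
have : nbhs (1%:M : 'M[R]_2) W.
  by apply: open_nbhs_nbhs; split => //; move: U1; rewrite -WU.
move=> /nbhs_ballP[eps /= eps0 epsW]; exists eps => // A Ae.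
apply: UV; rewrite -WU; apply: epsW; split => // i j.
by rewrite /ball /= mxE distrC.
Qed.

End MobiusAction.

Section DiscreteGroups.
Local Open Scope classical_set_scope.
Local Open Scope ring_scope.
Local Open Scope quotient_scope.

Variable R : realType.

(* Treats [SL2] and its quotient [PSL2] at once: [pi] is the projection and
   [rep] a section of it. *)
Lemma discrete_quotient_grid_free (T : groupType) (pi : SL2 R -> T)
    (rep : T -> SL2 R) (G : set T) (eps : R) :
  {morph pi : A B / (A * B)%g} -> cancel rep pi ->
  (forall A, moeb_re (rep (pi A)) = moeb_re A) ->
  (forall A, moeb_im (rep (pi A)) = moeb_im A) ->
  subgroup G -> 0 < eps ->
  (forall A : SL2 R, (forall i j, `|A i j - (i == j)%:R| < eps) ->
     G (pi A) -> pi A = 1%g) ->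
  grid_free G.
Proof.
move=> piM repK re_pi im_pi [G1 GM GV] eps0 sep.
have pi1 : pi 1%g = 1%g by apply: (@mulgI _ (pi 1%g)); rewrite -piM !mulg1.
have piV A : pi A^-1%g = (pi A)^-1%g.
  by apply: (@mulgI _ (pi A)); rewrite -piM !mulgV.
have coshE f g : orbit2cosh (@moeb_re R \o rep) (@moeb_im R \o rep) f (f * g)%g =
    sl2_sqnorm (rep g).
  rewrite /orbit2cosh /= -[in (f * g)%g](repK f) -[in (_ * g)%g](repK g) -piM.
  by rewrite re_pi im_pi hyp2cosh_moeb.
apply: (@proper_grid_free R T (@moeb_re R \o rep) (@moeb_im R \o rep)).
- by move=> g; exact: moeb_im_gt0.
- by move=> f g h; rewrite -[h in LHS](mulVKg g) -[h in RHS](mulVKg g) mulgA !coshE.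
move=> r.
(* Only chosen representatives are counted: among them [pi A = pi B] forces [A = B], whereas in the
   case of [PSL2] a class contains two matrices. *)
have [s sP] : exists s : seq (SL2 R), forall A,
    [/\ rep (pi A) = A, G (pi A) & sl2_sqnorm A <= r] -> A \in s.
  apply: (@sl2_proper_finite R _ eps r) => // [A B [rA GA _] [rB GB _] near1|A []//].
  have : pi (A^-1 * B)%g = 1%g.
    by apply: sep => //; rewrite piM piV; apply: GM => //; exact: GV.
  by rewrite piM piV => e; rewrite -rA -rB -[pi B](mulVKg (pi A)) e mulg1.
exists (map pi s) => g Gg; rewrite -[g in orbit2cosh _ _ _ g]mul1g coshE => gr.
by rewrite -(repK g); apply: map_f; apply: sP; rewrite repK.
Qed.

Lemma sl2_discrete_grid_free (G : set (SL2 R)) :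
  subgroup G -> discrete_subset G -> grid_free G.
Proof.
move=> Gs disc; have [G1 _ _] := Gs.
have [_ [V V1 VG]] := disc _ G1.
have [eps eps0 epsV] := nbhs1_sl2 V1.
apply: (@discrete_quotient_grid_free _ id id G eps) => // A Ae GA.
have : (V `&` G) A by split => //; exact: epsV.
by rewrite VG.
Qed.

Lemma moeb_pm_eq (A B : SL2 R) :
  pm_eq A B -> moeb_re A = moeb_re B /\ moeb_im A = moeb_im B.
Proof.
rewrite /moeb_re /moeb_im => /orP[]/eqP->; rewrite ?mxE //.
by rewrite !sqrrN !mulrNN.
Qed.

Lemma psl2_discrete_grid_free (G : set (PSL2 R)) :
  subgroup G -> discrete_subset G -> grid_free G.
Proof.
move=> Gs disc; have [G1 _ _] := Gs.
have [_ [V V1 VG]] := disc _ G1.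
have /nbhs1_sl2[eps eps0 epsV] : nbhs (1%g : SL2 R) (@psl2_pi R @^-1` V).
  exact: (@pi_continuous _ {eq_quot (pm_equiv R)} (1%g : SL2 R)).
apply: (@discrete_quotient_grid_free _ (@psl2_pi R) (@psl2_repr R) G eps) => //.
- exact: psl2_piM.
- exact: psl2_reprK.
- by move=> A; have [] := moeb_pm_eq (psl2_repr_pi A).
- by move=> A; have [] := moeb_pm_eq (psl2_repr_pi A).
- move=> A Ae GA; have : (V `&` G) (psl2_pi A) by split => //; exact: epsV.
  by rewrite VG.
Qed.

End DiscreteGroups.

(** * Words, walks and box spaces *)

Section Words.
Local Open Scope classical_set_scope.
Local Open Scope group_scope.

Variables (T : groupType) (S : set T).

Lemma word_ball1 n : word_ball S n 1.
Proof. by exists [::]; split => //; rewrite big_nil. Qed.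

Lemma word_ballM a b g h :
  word_ball S a g -> word_ball S b h -> word_ball S (a + b) (g * h).
Proof.
move=> [u [us uS ->]] [v [vs vS ->]]; exists (u ++ v); split.
- by rewrite size_cat leq_add.
- by move=> x; rewrite mem_cat => /orP[/uS|/vS].
- by rewrite big_cat.
Qed.

Lemma word_ballV a g : word_ball S a g -> word_ball S a g^-1.
Proof.
move=> [u [us uS ->]]; exists (rev [seq x^-1 | x <- u]); split.
- by rewrite size_rev size_map.
- move=> y; rewrite mem_rev => /mapP[x xu ->]; rewrite invgK.
  by case: (uS x xu); [right|left].
- elim: u {us uS} => [|x u IH]; first by rewrite !big_nil invg1.
  by rewrite big_cons invgM IH /= rev_cons -cats1 big_cat /= big_seq1.
Qed.

Lemma word_ballS a b g : (a <= b)%N -> word_ball S a g -> word_ball S b g.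
Proof. by move=> ab [u [us uS ->]]; exists u; split => //; exact: leq_trans ab. Qed.

Lemma word_ball_letter g : S g -> word_ball S 1 g.
Proof.
move=> Sg; exists [:: g]; split; rewrite ?big_seq1 // => x.
by rewrite inE => /eqP->; left.
Qed.

Lemma gen_subgroup_subgroup : subgroup (gen_subgroup S).
Proof.
split.
- by move=> H [[]].
- by move=> x y Sx Sy H HS; case: (HS) => -[_ HM _] _; apply: HM; [exact: Sx|exact: Sy].
- by move=> x Sx H HS; case: (HS) => -[_ _ HV] _; apply: HV; exact: Sx.
Qed.

Lemma sub_gen_subgroup : S `<=` gen_subgroup S.
Proof. by move=> x Sx H [_]; exact. Qed.

Lemma word_ball_gen n g : word_ball S n g -> gen_subgroup S g.
Proof.
have [G1 GM GV] := gen_subgroup_subgroup.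
move=> [w [_ wS ->]]; elim: w wS => [|x w IH] wS; first by rewrite big_nil.
rewrite big_cons; apply: GM.
  have [|/sub_gen_subgroup//|/sub_gen_subgroup/GV] := wS x; first exact: mem_head.
  by rewrite invgK.
by apply: IH => y yw; apply: wS; rewrite inE yw orbT.
Qed.

Lemma gen_word_ball g : gen_subgroup S g -> exists n, word_ball S n g.
Proof.
move=> /(_ [set h | exists n, word_ball S n h]); apply; split;
  last by move=> x Sx; exists 1%N; exact: word_ball_letter.
split; first by exists 0%N; exact: word_ball1.
  by move=> x y [a xa] [b yb]; exists (a + b)%N; exact: word_ballM.
by move=> x [a xa]; exists a; exact: word_ballV.
Qed.

Lemma word_ball_finite n : finite_set S ->
  exists s : seq T, forall g, word_ball S n g -> g \in s.
Proof.
move=> /finite_seqP[s0 s0E].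
elim: n => [|n [s sP]].
  exists [:: 1] => g [w [w0 _ ->]].
  by rewrite (size0nil (_ : size w = 0%N)) ?big_nil ?inE //; apply/eqP; rewrite -leqn0.
pose s1 := s0 ++ [seq x^-1 | x <- s0].
exists (s ++ [seq x * y | x <- s1, y <- s]) => g [[|x w] [wn wS ->]].
  by rewrite big_nil mem_cat sP //; exact: word_ball1.
rewrite big_cons mem_cat; apply/orP; right; apply: allpairs_f.
  have s0S y : S y -> y \in s0 by rewrite s0E.
  have [|/s0S xs|/s0S xs] := wS x; first exact: mem_head.
    by rewrite mem_cat xs.
  by rewrite mem_cat -[x]invgK map_f ?orbT.
by apply: sP; exists w; split => // y yw; apply: wS; rewrite inE yw orbT.
Qed.

Lemma word_ball_sub (S' : set T) n : S `<=` S' -> word_ball S n `<=` word_ball S' n.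
Proof. by move=> SS' g [w [wn wS ->]]; exists w; split => // x /wS[/SS'|/SS']; tauto. Qed.

End Words.

Section Walks.
Local Open Scope classical_set_scope.
Local Open Scope ring_scope.

Variable R : realType.

(** A small value of [gdist] proves nothing for disconnected vertices, where it is 0; a walk carries
    the path itself. *)
Definition walk (X : sgraph) (n : nat) (x y : X) : Prop :=
  exists p, [/\ path (@adj X) x p, last x p = y & (size p <= n)%N].

Lemma walk0 (X : sgraph) n (x : X) : walk n x x.
Proof. by exists [::]. Qed.

Lemma walk_trans (X : sgraph) a b (x y z : X) :
  walk a x y -> walk b y z -> walk (a + b) x z.
Proof.
move=> [p [pp pl ps]] [q [qp ql qs]]; exists (p ++ q).
by rewrite cat_path last_cat size_cat pp pl qp ql leq_add.
Qed.

Lemma walkS (X : sgraph) a b (x y : X) : (a <= b)%N -> walk a x y -> walk b x y.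
Proof. by move=> ab [p [pp pl ps]]; exists p; split => //; exact: leq_trans ab. Qed.

Lemma walk_sym (X : sgraph) n (x y : X) : walk n x y -> walk n y x.
Proof.
move=> [p [pp <- /walkS]]; apply.
elim/last_ind: p pp => [|p z IH]; first by move=> _; exact: walk0.
rewrite rcons_path last_rcons size_rcons -add1n => /andP[/IH h pz].
by apply: walk_trans h; exists [:: last x p]; rewrite /= andbT adj_sym.
Qed.

Lemma gdist_lbound (X : sgraph) (x y : X) :
  lbound [set ((size p)%:R : R) | p in [set p : seq X | path (@adj X) x p /\ last x p = y]] 0.
Proof. by move=> _ [p _ <-]. Qed.

Lemma walk_gdist (X : sgraph) n (x y : X) : walk n x y -> gdist R x y <= n%:R.
Proof.
move=> [p [pp pl ps]]; apply: (@le_trans _ _ (size p)%:R); last by rewrite ler_nat.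
apply: ge_inf; last by exists p.
by exists 0; exact: gdist_lbound.
Qed.

Lemma gdist_ge0 (X : sgraph) (x y : X) : 0 <= gdist R x y.
Proof.
rewrite /gdist; set A := (X in inf X).
have [->|/set0P A0] := eqVneq A set0; first by rewrite inf0.
by apply: lb_le_inf => //; exact: gdist_lbound.
Qed.

Lemma gdist_walk (X : sgraph) n (x y : X) : (exists m, walk m x y) ->
  gdist R x y <= n%:R -> walk n x y.
Proof.
move=> [m [p [pp pl ps]]] d.
set A := [set ((size p)%:R : R) | p in [set p : seq X | path (@adj X) x p /\ last x p = y]].
have Ainf : has_inf A.
  by split; [exists (size p)%:R, p|exists 0; exact: gdist_lbound].
(* Path lengths are integers, so a path shorter than the infimum plus 1 has length at most [n]. *)
have [_ [q [qp ql] <-]] := inf_adherent ltr01 Ainf.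
move=> h; exists q; split => //.
rewrite -ltnS -(ltr_nat R) -natr1; apply: lt_le_trans h _.
by rewrite lerD2r.
Qed.

(** Otherwise the component of [x] or its complement is nonempty, has at most half of the vertices
    and has no boundary edge, so the Cheeger constant is at most 0. *)
Lemma expander_connected (X : nat -> sgraph) n (x y : X n) :
  expander R X -> exists m, walk m x y.
Proof.
move=> [_ _ [c c0 cX]].
pose A := [set z | connect (@adj (X n)) x z]%SET.
suff : y \in A by rewrite inE => /connectP[p pp pl]; exists (size p), p.
apply/negP => /negP yA.
have closed (B : {set X n}) : (0 < #|B|)%N -> (2 * #|B| <= #|X n|)%N ->
    (forall u v, u \in B -> adj u v -> v \in B) -> False.
  move=> B0 B2 Bc; suff : (c%:E <= 0%:E)%E by rewrite lee_fin leNgt c0.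
  apply: le_trans (cX n) _; apply: ereal_inf_lbound; exists B => //.
  rewrite (_ : edge_boundary B = finset.set0) ?cards0 ?mul0r //.
  apply/setP => -[u v]; rewrite !inE /=; apply/negP => /and3P[uB vB uv].
  by rewrite (Bc u v) in vB.
have Ac u v : u \in A -> adj u v -> v \in A.
  by rewrite !inE => xu uv; apply: connect_trans xu _; exact: connect1.
have [h|h] := leqP (2 * #|A|) #|X n|.
  by apply: (closed A) => //; apply/card_gt0P; exists x; rewrite inE connect0.
apply: (closed (~: A)%SET).
- by apply/card_gt0P; exists y; rewrite inE.
- by have := cardsC A; lia.
- move=> u v; rewrite inE => uA uv; rewrite inE; apply: contra uA => vA.
  by apply: Ac vA _; rewrite adj_sym.
Qed.

Lemma walk_card (X : sgraph) (D n : nat) (x : X) :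
  (forall y : X, (#|[set z | adj y z]%SET| <= D)%N) ->
  (forall y, walk n x y) -> (#|X| <= D.+1 ^ n)%N.
Proof.
move=> deg all_walk.
pose B := fix B k : {set X} := if k is k'.+1 then
  (B k' :|: \bigcup_(y in B k') [set z | adj y z])%SET else [set x]%SET.
have cB k : (#|B k| <= D.+1 ^ k)%N.
  elim: k => [|k IH] /=; first by rewrite cards1.
  apply: leq_trans (leq_card_setU _ _) _.
  have h : (#|(\bigcup_(y in B k) [set z | adj y z])%SET| <= #|B k| * D)%N.
    rewrite -sum_nat_const; elim/big_rec2: _ => [|y m U _ h]; first by rewrite cards0.
    apply: leq_trans (leq_card_setU _ _) _; exact: leq_add.
  rewrite expnS mulSn; apply: leq_add => //; apply: leq_trans h _.
  by rewrite mulnC leq_mul2l IH orbT.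
have memB p k : path (@adj X) x p -> (size p <= k)%N -> last x p \in B k.
  elim/last_ind: p k => [|p y IH] k.
    by move=> _ _; elim: k => [|k IH] /=; rewrite inE ?IH.
  rewrite rcons_path last_rcons size_rcons => /andP[pp py]; case: k => // k pk.
  rewrite /= inE; apply/orP; right; apply/finset.bigcupP; exists (last x p); first exact: IH.
  by rewrite inE.
apply: leq_trans (cB n); rewrite -cardsT subset_leq_card //.
by apply/fintype.subsetP => y _; have [p [pp <- ps]] := all_walk y; exact: memB.
Qed.

End Walks.

Section BoxSpaceGrids.
Local Open Scope classical_set_scope.
Local Open Scope group_scope.

Variable T : groupType.

Lemma lcoset_set_eq (N : set T) g h : subgroup N ->
  lcoset_set N g = lcoset_set N h -> N (g^-1 * h).
Proof.
move=> [N1 _ _] /(congr1 (fun A => A h)); rewrite /lcoset_set /= => ->.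
by rewrite mulVg.
Qed.

Lemma eq_lcoset_set (N : set T) g h : subgroup N ->
  N (g^-1 * h) -> lcoset_set N g = lcoset_set N h.
Proof.
move=> [N1 NM NV] gh.
have hg : N (h^-1 * g) by rewrite -[h^-1 * g]invgK invgM invgK; exact: NV.
rewrite /lcoset_set; apply/seteqP; split=> x /= xN.
  by rewrite -(mulVKg g x) mulgA; exact: NM.
by rewrite -(mulVKg h x) mulgA; exact: NM.
Qed.

(** An edge is given through some representative [h] of the current coset, not through the
    representative [g * u] reached so far. Normality of [N] allows both to be multiplied on the
    right by the same generator or inverse generator. *)
Lemma walk_word (G N S : set T) (X : sgraph) (phi : X -> set T) :
  S `<=` G -> subgroup G -> normal_in N G ->
  (forall x y : X, adj x y <-> x <> y /\ exists g s,
        [/\ G g, S s &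
            (phi x = lcoset_set N g /\ phi y = lcoset_set N (g * s)) \/
            (phi y = lcoset_set N g /\ phi x = lcoset_set N (g * s))]) ->
  forall n x y g, G g -> phi x = lcoset_set N g -> walk n x y ->
  exists2 u, word_ball S n u & phi y = lcoset_set N (g * u).
Proof.
move=> SG [G1 GM GV] [Ns NG Nn] adjP n x y g Gg xg [p [pp <- pn]].
suff : exists2 u, word_ball S (size p) u & phi (last x p) = lcoset_set N (g * u).
  by case=> u /(word_ballS pn); exists u.
have [N1 NM NV] := Ns.
elim/last_ind: p {pn} pp => [|p z IH]; first by exists 1; rewrite ?mulg1 //; exact: word_ball1.
rewrite rcons_path last_rcons size_rcons => /andP[/IH[u uS eu] /adjP[_ [h [s [Gh Ss]]]]].
rewrite eu => hs.
have step t : G t -> N (h^-1 * (g * u)) -> lcoset_set N (h * t) = lcoset_set N (g * (u * t)).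
  move=> Gt hN; apply: eq_lcoset_set => //.
  by rewrite invgM -(mulgA t^-1) !mulgA -[_ * g * u * t]mulgA; have := Nn t _ Gt hN; rewrite !mulgA.
case: hs => -[e1 e2].
  exists (u * s); first by rewrite -addn1; apply: word_ballM => //; exact: word_ball_letter.
  rewrite e2; apply: step; first exact: SG.
  by apply: lcoset_set_eq => //; rewrite -e1.
exists (u * s^-1).
  by rewrite -addn1; apply: word_ballM => //; apply: word_ballV; exact: word_ball_letter.
rewrite e1 mulgA.
have hN := lcoset_set_eq Ns (esym e2).
have Gs : G s^-1 by apply/GV/SG.
apply: eq_lcoset_set => //.
have := Nn s^-1 _ Gs hN.
by rewrite invgM !invgK !mulgA mulgV mul1g.
Qed.

(** Each grid point is lifted to a word of length at most [C * W] read from a representative [g0] of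
    [x0]. For neighbouring points the lifts agree with a short step up to an element of [N n] of
    bounded length, which is trivial once [n] is large; so the lifted grid is Lipschitz in [G]. *)
Lemma box_space_grid_free (G : set T) (X : nat -> sgraph) :
  grid_free G -> box_space G X -> forall D C0 C : nat,
  exists W0 : nat, forall W, (W0 <= W)%N -> exists n0, forall n, (n0 <= n)%N ->
  ~ exists (x0 : X n) (f : 'I_(W ^ 2) * 'I_(W ^ 2) -> X n),
    [/\ forall p, walk (C * W) x0 (f p),
        forall p q, grid_adj p q -> walk D (f p) (f q)
      & forall x, (#|[set p | f p == x]%SET| <= C0)%N].
Proof.
move=> Gfree [S [N [[Sfin SG] Nn box cay]]] D C0 C.
have SsubG : S `<=` G by rewrite -SG; exact: sub_gen_subgroup.
have Gs : subgroup G by rewrite -SG; exact: gen_subgroup_subgroup.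
have [G1 GM GV] := Gs.
(* The radius is [D.+1] so that [F] contains the letters of [S] even when [D] is 0. *)
have [F FP] := word_ball_finite D.+1 Sfin.
have [W0 W0P] := Gfree F C0 C.
exists W0 => W /W0P nogrid.
(* This is the length of the closing element: back along the step of length [D] and one lift, then
   out along the other lift. *)
have [n0 n0P] := box (C * W + D + C * W)%N.
exists n0 => n n0n [x0 [f [fD fadj ffib]]]; apply: nogrid.
have [phi phi_bij adjP] := cay n.
have [Nnorm _] := Nn n; have [Ns NG _] := Nnorm.
have [g0 Gg0 x0g] : coset_space G (N n) (phi x0).
  by have [h _ _] := phi_bij; apply: h.
have lift := walk_word SsubG Gs Nnorm adjP.
have /choice[w wP] p : exists w, word_ball S (C * W) w /\
    phi (f p) = lcoset_set (N n) (g0 * w).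
  by have [u uS up] := lift _ _ _ _ Gg0 (esym x0g) (fD p); exists u.
have wG p : G (w p) by rewrite -SG; have [/word_ball_gen] := wP p.
exists w; split.
- by move=> p q; apply: GM => //; exact: GV.
- move=> p; have [+ _] := wP p; apply: word_ball_sub => s Ss.
  by apply: FP; apply: word_ballS (word_ball_letter Ss).
- move=> p q pq; have [wpS wp] := wP p; have [wqS wq] := wP q.
  have [u uS uq] := lift _ _ _ _ (GM _ _ Gg0 (wG p)) wp (fadj p q pq).
  have : N n ((w p * u)^-1 * w q).
    have := @lcoset_set_eq (N n) (g0 * w p * u) (g0 * w q) Ns.
    by rewrite -uq -wq => /(_ erefl); rewrite -mulgA invgM -mulgA mulKg.
  have : word_ball S (C * W + D + C * W)%N ((w p * u)^-1 * w q).
    by apply: word_ballM => //; apply: word_ballV; exact: word_ballM.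
  move=> hS hN.
  have : [set 1 : T] ((w p * u)^-1 * w q) by rewrite -n0P; split => //; exists n.
  move=> /= e; rewrite -[w q](mulVKg (w p * u)) e mulg1 mulKg; apply: FP.
  exact: word_ballS uS.
- move=> g; set A := [set p | _]%SET.
  have [->|[p0]] := set_0Vmem A; first by rewrite cards0.
  rewrite inE => /eqP wp0; apply: leq_trans (ffib (f p0)); apply: subset_leq_card.
  apply/fintype.subsetP => p; rewrite !inE => /eqP wp; apply/eqP.
  have [_ inj _] := phi_bij; apply: inj; rewrite ?inE //.
  by have [_ ->] := wP p; have [_ ->] := wP p0; rewrite wp wp0.
Qed.

End BoxSpaceGrids.

(** * A lower bound for the warped distance on the torus *)

Section TorusFunction.
Local Open Scope classical_set_scope.
Local Open Scope ring_scope.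

Variable R : realType.

Definition lin1 (g : SL2 int) (x y : R) : R := (g 0 0)%:~R * x + (g 0 1)%:~R * y.
Definition lin2 (g : SL2 int) (x y : R) : R := (g 1 0)%:~R * x + (g 1 1)%:~R * y.

Lemma lin1M g h x y : lin1 (g * h)%g x y = lin1 g (lin1 h x y) (lin2 h x y).
Proof. by rewrite /lin1 /lin2 !sl2_mulE !(intrD, intrM); ring. Qed.
Lemma lin2M g h x y : lin2 (g * h)%g x y = lin2 g (lin1 h x y) (lin2 h x y).
Proof. by rewrite /lin1 /lin2 !sl2_mulE !(intrD, intrM); ring. Qed.
Lemma lin11 x y : lin1 1%g x y = x.
Proof. by rewrite /lin1 /= !mxE /=; ring. Qed.
Lemma lin21 x y : lin2 1%g x y = y.
Proof. by rewrite /lin2 /= !mxE /=; ring. Qed.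

Variables (S : set (SL2 int)) (r L : nat) (t c1 c2 : R).

Hypothesis t_gt0 : 0 < t.
Hypothesis L_gt0 : (0 < L)%N.
Hypothesis L_bound : forall g : SL2 int, word_ball S r g ->
  (absz (g 0%R 0%R) + absz (g 0%R 1%R) + absz (g 1%R 0%R) + absz (g 1%R 1%R) <= L)%N.

(** A cost pays 1 per letter of a word [g], then for the remaining distance on the torus. The factor
    [1 / L] compensates the stretching by words of length at most [r], and the constant cost [r]
    takes over when a word would become longer. *)
Definition orbit_costs (x y : R) : set R :=
  [set e | e = r%:R \/ exists (j : nat) (g : SL2 int) (m1 m2 : int),
    [/\ (j <= r)%N, word_ball S j g &
        e = j%:R + t / L%:R *
              (`|lin1 g x y - c1 - m1%:~R| + `|lin2 g x y - c2 - m2%:~R|)]].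

(* A lower bound, truncated at [r], for the warped distance from the point
   with coordinates [(c1, c2)] modulo the lattice. *)
Definition orbit_cost (x y : R) : R := inf (orbit_costs x y).

Let tL0 : 0 < t / L%:R. Proof. by rewrite divr_gt0 // ltr0n. Qed.

Lemma orbit_costs_lb x y : lbound (orbit_costs x y) 0.
Proof.
move=> e [->|[j [g [m1 [m2 [_ _ ->]]]]]]; first exact: ler0n.
by rewrite addr_ge0 // mulr_ge0 ?(ltW tL0) // addr_ge0.
Qed.

Lemma orbit_costs_inf x y : has_inf (orbit_costs x y).
Proof. by split; [exists r%:R; left|exists 0; exact: orbit_costs_lb]. Qed.

Lemma orbit_cost_ge0 x y : 0 <= orbit_cost x y.
Proof. by apply: lb_le_inf; [case: (orbit_costs_inf x y)|exact: orbit_costs_lb]. Qed.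

Lemma orbit_cost_le x y x' y' del :
  (forall e, orbit_costs x y e -> exists2 e', orbit_costs x' y' e' & e' <= e + del) ->
  orbit_cost x' y' <= orbit_cost x y + del.
Proof.
move=> h; rewrite -lerBlDr; apply: lb_le_inf; first by case: (orbit_costs_inf x y).
move=> e /h[e' e'P le]; rewrite lerBlDr; apply: le_trans le.
by apply: ge_inf e'P; case: (orbit_costs_inf x' y').
Qed.

Lemma orbit_cost_periodic x y (m1 m2 : int) :
  orbit_cost (x + m1%:~R) (y + m2%:~R) = orbit_cost x y.
Proof.
have main x' y' (n1 n2 : int) : orbit_cost (x' + n1%:~R) (y' + n2%:~R) <= orbit_cost x' y'.
  rewrite -[leRHS]addr0; apply: orbit_cost_le => e [->|[j [g [k1 [k2 [jr gj ->]]]]]].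
    by exists r%:R; rewrite ?addr0 //; left.
  exists (j%:R + t / L%:R *
              (`|lin1 g x' y' - c1 - k1%:~R| + `|lin2 g x' y' - c2 - k2%:~R|)); last by rewrite addr0.
  right; exists j, g, (k1 + (g 0 0 * n1 + g 0 1 * n2)), (k2 + (g 1 0 * n1 + g 1 1 * n2)).
  split => //; congr (_ + _); congr (_ * _); congr (_ + _); congr Num.norm;
    rewrite /lin1 /lin2 !(intrD, intrM); ring.
apply/le_anti/andP; split=> //.
have := main (x + m1%:~R) (y + m2%:~R) (- m1) (- m2).
by rewrite !intrN !addrK.
Qed.

Lemma orbit_cost_lipschitz x y x' y' d : `|x - x'| <= d -> `|y - y'| <= d ->
  orbit_cost x' y' <= orbit_cost x y + t * d.
Proof.
move=> xd yd; have d0 : 0 <= d by exact: le_trans xd.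
apply: orbit_cost_le => e [->|[j [g [k1 [k2 [jr gj ->]]]]]].
  by exists r%:R; [left|rewrite lerDl mulr_ge0 // ltW].
eexists; first by right; exists j, g, k1, k2; split => //.
rewrite -[leRHS]addrA lerD2l.
have dd : t * d = t / L%:R * (L%:R * d) by rewrite mulrA divfK // pnatr_eq0 -lt0n.
rewrite dd -mulrDr ler_pM2l //.
have ab (a b : int) c m : `|a%:~R * x' + b%:~R * y' - c - m| <=
    `|a%:~R * x + b%:~R * y - c - m| + ((absz a + absz b)%N%:R * d : R).
  have -> : a%:~R * x' + b%:~R * y' - c - m =
    (a%:~R * x + b%:~R * y - c - m) - (a%:~R * (x - x') + b%:~R * (y - y')) :> R by ring.
  apply: le_trans (ler_normB _ _) _; rewrite lerD2l.
  apply: le_trans (ler_normD _ _) _; rewrite !normrM natrD mulrDl.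
  by rewrite -!intr_norm -!abszE -!pmulrn lerD // ler_wpM2l.
have h1 := ab (g 0 0) (g 0 1) c1 k1%:~R.
have h2 := ab (g 1 0) (g 1 1) c2 k2%:~R.
have h3 : ((absz (g 0%R 0%R) + absz (g 0%R 1%R))%N%:R * d +
    (absz (g 1%R 0%R) + absz (g 1%R 1%R))%N%:R * d : R) <= L%:R * d.
  by rewrite -mulrDl -natrD ler_wpM2r // ler_nat addnA L_bound //; exact: word_ballS gj.
by rewrite /lin1 /lin2; lra.
Qed.

(** Replacing [g] by [g s^-1] reaches the same place with one more letter; if [g] already uses [r]
    letters, its cost is at least the truncation value [r]. *)
Lemma orbit_cost_step s x y : S s \/ S s^-1%g ->
  orbit_cost (lin1 s x y) (lin2 s x y) <= orbit_cost x y + 1.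
Proof.
move=> Ss; apply: orbit_cost_le => e [->|[j [g [k1 [k2 [jr gj ->]]]]]].
  by exists r%:R; [left|rewrite lerDl].
have e0 : 0 <= t / L%:R *
    (`|lin1 g x y - c1 - k1%:~R| + `|lin2 g x y - c2 - k2%:~R|).
  by rewrite mulr_ge0 ?(ltW tL0) // addr_ge0.
have := jr; rewrite leq_eqVlt => /orP[/eqP ej|jr'].
  by exists r%:R; [left|rewrite -ej; lra].
exists (j.+1%:R + t / L%:R *
    (`|lin1 g x y - c1 - k1%:~R| + `|lin2 g x y - c2 - k2%:~R|)); last by rewrite -natr1; lra.
right; exists j.+1, (g * s^-1)%g, k1, k2; split => //.
  rewrite -addn1; apply: word_ballM => //.
  by case: Ss => /word_ball_letter // /word_ballV.
by rewrite -!(lin1M, lin2M) -mulgA mulVg mulg1.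
Qed.

Lemma orbit_cost_step_dist s x y : S s \/ S s^-1%g ->
  `|orbit_cost (lin1 s x y) (lin2 s x y) - orbit_cost x y| <= 1.
Proof.
move=> Ss; have := orbit_cost_step x y Ss.
have : S s^-1%g \/ S s^-1%g^-1%g by rewrite invgK; tauto.
move=> /(orbit_cost_step (lin1 s x y) (lin2 s x y)).
rewrite -lin1M -lin2M mulVg lin11 lin21 ler_distl => h1 h2.
by apply/andP; split; lra.
Qed.

Lemma orbit_cost_base : orbit_cost c1 c2 = 0.
Proof.
apply/le_anti/andP; split; last exact: orbit_cost_ge0.
apply: ge_inf; first by case: (orbit_costs_inf c1 c2).
right; exists 0%N, 1%g, 0, 0; split => //; first exact: word_ball1.
have e0 (c : R) : `|c - c - (0 : int)%:~R| = 0 by rewrite subrr sub0r normrN normr0.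
by rewrite lin11 lin21 !e0 addr0 mulr0 addr0.
Qed.

Lemma orbit_cost_small x y (b : R) : orbit_cost x y < b -> b <= r%:R ->
  exists (g : SL2 int) (m1 m2 : int), [/\ word_ball S r g,
    t * `|lin1 g x y - c1 - m1%:~R| < L%:R * b &
    t * `|lin2 g x y - c2 - m2%:~R| < L%:R * b].
Proof.
move=> hb br.
have := inf_adherent (_ : 0 < b - orbit_cost x y) (orbit_costs_inf x y).
rewrite subr_gt0 => /(_ hb)[e eP]; rewrite -/(orbit_cost x y) addrC subrK => eb.
case: eP eb => [->|[j [g [m1 [m2 [jr gj ->]]]]] eb]; first by rewrite ltNge br.
have L0 : 0 < L%:R :> R by rewrite ltr0n.
have E z : t * z = L%:R * (t / L%:R * z) by field; rewrite gt_eqF.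
exists g, m1, m2; split; first exact: word_ballS gj.
all: have j0 : 0 <= j%:R :> R by exact: ler0n.
all: rewrite E ltr_pM2l //.
all: move: eb; rewrite mulrDr.
all: have := mulr_ge0 (ltW tL0) (normr_ge0 (lin1 g x y - c1 - m1%:~R)).
all: have := mulr_ge0 (ltW tL0) (normr_ge0 (lin2 g x y - c2 - m2%:~R)).
all: lra.
Qed.

End TorusFunction.

Section OrbitCostCount.
Local Open Scope classical_set_scope.
Local Open Scope ring_scope.

Variable R : realType.

Definition sl2_height (g : SL2 int) : nat :=
  (absz (g 0%R 0%R) + absz (g 0%R 1%R) + absz (g 1%R 0%R) + absz (g 1%R 1%R))%N.

Lemma word_ball_height (S : set (SL2 int)) (n : nat) : finite_set S ->
  exists L, (0 < L)%N /\ forall g, word_ball S n g -> (sl2_height g <= L)%N.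
Proof.
move=> /(word_ball_finite n)[s sP].
have [L LP] : exists L, forall g, g \in s -> (sl2_height g <= L)%N.
  elim: s {sP} => [|g s [L LP]]; first by exists 0%N.
  exists (maxn L (sl2_height g)) => h; rewrite inE => /orP[/eqP->|/LP hL].
    exact: leq_maxr.
  by rewrite leq_max hL.
by exists L.+1; split => // g /sP/LP; exact: leqW.
Qed.

(** Near the corner the periodicity is invisible: the integer [z] has absolute value at most
    [L M + M], so for nonzero [m] the difference [z - m T] would have absolute value at least
    [K]. *)
Lemma lattice_offset (T M K L u v u0 : nat) (a b m : int) : (0 < T)%N ->
  (absz a + absz b <= L)%N -> (u < M)%N -> (v < M)%N -> (u0 < M)%N ->
  (K + L * M + M <= T)%N ->
  T%:R * `|a%:~R * (u%:R / T%:R) + b%:~R * (v%:R / T%:R) - u0%:R / T%:R - m%:~R| < K%:R :> R ->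
  (absz (a * u%:Z + b * v%:Z - u0%:Z)%R < K)%N.
Proof.
move=> T0 abL uM vM u0M TK.
have T0' : 0 < T%:R :> R by rewrite ltr0n.
rewrite -{1}[T%:R]ger0_norm ?ltW // -normrM.
set z := a * u%:Z + b * v%:Z - u0%:Z.
have -> : T%:R * (a%:~R * (u%:R / T%:R) + b%:~R * (v%:R / T%:R) - u0%:R / T%:R - m%:~R) =
    (z - m * T%:Z)%:~R :> R.
  rewrite /z !(intrB, intrD, intrM) -!pmulrn.
  by field; rewrite gt_eqF.
rewrite -intr_norm -abszE -pmulrn ltr_nat => zK.
have zb : (absz z <= L * M + M)%N.
  apply: (@leq_trans (absz a * u + absz b * v + u0)); first by rewrite /z; lia.
  have : (absz a * u + absz b * v <= (absz a + absz b) * M)%N by rewrite mulnDl leq_add // leq_mul2l ltnW ?orbT.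
  have : ((absz a + absz b) * M <= L * M)%N by rewrite leq_mul2r abL orbT.
  by lia.
have [m0|m0] := eqVneq m 0; first by move: zK; rewrite m0 mul0r subr0.
have : (T <= absz (m * T%:Z)%R)%N by rewrite abszM /= leq_pmull // absz_gt0.
lia.
Qed.

(** A cheap point [p] is determined by a matrix [g] from a finite ball and the offset [g p - p0]
    from a box of fixed size, because [g] is invertible. The bound is therefore independent of [M]
    and [T]. Truncation at [r.+1] keeps costs up to [r] below the truncation value. *)
Lemma orbit_cost_count (S : set (SL2 int)) (r L : nat) : finite_set S -> (0 < L)%N ->
  (forall g, word_ball S r.+1 g -> (sl2_height g <= L)%N) ->
  exists C : nat, forall M : nat, exists T0 : nat, forall T, (T0 < T)%N ->
  forall p0 : 'I_M * 'I_M,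
  (#|[set p : 'I_M * 'I_M | (orbit_cost S r.+1 L T%:R (p0.1%:R / T%:R) (p0.2%:R / T%:R)
      (p.1%:R / T%:R) (p.2%:R / T%:R) <= r%:R :> R)%R]%SET| <= C)%N.
Proof.
move=> Sfin L0 hL; have [B BP] := word_ball_finite r.+1 Sfin.
(* This is the bound of [orbit_cost_small] for costs below [r.+1], after clearing the factor
   [1 / L]. *)
pose K := (L * r.+1)%N.
pose Z : seq int := [seq n%:Z - K%:Z | n <- iota 0 (K + K)].
have ZP z : (absz z < K)%N -> z \in Z.
  move=> zK; apply/mapP; exists (absz (z + K%:Z)); last by lia.
  by rewrite mem_iota; lia.
pose s := [seq (g, ij) | g <- B, ij <- [seq (i, j) | i <- Z, j <- Z]].
exists (size s) => M; exists (K + L * M + M)%N => T TT0 p0.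
have T0 : (0 < T)%N by lia.
set A := [set p | _]%SET.
pose off (g : SL2 int) (p : 'I_M * 'I_M) : int * int :=
  (g 0 0 * (p.1 : nat)%:Z + g 0 1 * (p.2 : nat)%:Z - (p0.1 : nat)%:Z,
   g 1 0 * (p.1 : nat)%:Z + g 1 1 * (p.2 : nat)%:Z - (p0.2 : nat)%:Z).
have /choice[g gP] (p : 'I_M * 'I_M) : exists g, p \in A -> (g, off g p) \in s.
  have [|_] := boolP (p \in A); last by exists 1%g.
  rewrite inE => pA.
  have T0' : 0 < T%:R :> R by rewrite ltr0n.
  have pA' := le_lt_trans pA (_ : r%:R < r.+1%:R :> R).
  have [|g [m1 [m2 [gB h1 h2]]]] := orbit_cost_small T0' L0 (pA' _) (lexx _).
    by rewrite ltr_nat.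
  exists g => _; apply: allpairs_f; first exact: BP.
  have hg := hL _ gB; rewrite -natrM in h1 h2.
  apply: allpairs_f; apply: ZP.
    by apply: (@lattice_offset T M K L _ _ _ _ _ m1) h1 => //; [|exact: ltnW];
      apply: leq_trans hg; rewrite /sl2_height -!addnA leq_add2l leq_addr.
  by apply: (@lattice_offset T M K L _ _ _ _ _ m2) h2 => //; [|exact: ltnW];
    apply: leq_trans hg; rewrite /sl2_height -[X in (_ <= X)%N]addnA leq_addl.
rewrite -[size s]muln1.
apply: (@card_le_fibers _ _ (fun p => (g p, off (g p) p))) => [p /gP//|c].
apply/card_le1_eqP => p q; rewrite !inE => /andP[_ /eqP e1] /andP[_ /eqP e2].
have [e3] : (g p, off (g p) p) = (g q, off (g q) q) by rewrite e1 e2.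
rewrite -e3 => e4 e5; have d := sl2_det (g p).
have [x y] : (p.1 : nat)%:Z = (q.1 : nat)%:Z /\ (p.2 : nat)%:Z = (q.2 : nat)%:Z.
  move: e4 e5 d; move: (g p 0 0) (g p 0 1) (g p 1 0) (g p 1 1) => a b c' d' e4 e5 dd.
  have E (x y x' y' : int) : a * x + b * y - p0.1%:Z = a * x' + b * y' - p0.1%:Z ->
     c' * x + d' * y - p0.2%:Z = c' * x' + d' * y' - p0.2%:Z -> x = x' /\ y = y'.
    move=> /addIr h1 /addIr h2; split.
      transitivity ((a * d' - b * c') * x); first by rewrite dd mul1r.
      transitivity ((a * d' - b * c') * x'); last by rewrite dd mul1r.
      transitivity (d' * (a * x + b * y) - b * (c' * x + d' * y)); first by ring.
      by rewrite h1 h2; ring.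
    transitivity ((a * d' - b * c') * y); first by rewrite dd mul1r.
    transitivity ((a * d' - b * c') * y'); last by rewrite dd mul1r.
    transitivity (a * (c' * x + d' * y) - c' * (a * x + b * y)); first by ring.
    by rewrite h1 h2; ring.
  exact: E.
case: p q x y {e1 e2 e3 e4 e5 d} => p1 p2 [q1 q2] /= [x] [y].
by congr pair; apply/val_inj.
Qed.

End OrbitCostCount.

(** * Coordinates on an origami surface *)

Section OrigamiCoordinates.
Local Open Scope classical_set_scope.
Local Open Scope ring_scope.
Local Open Scope quotient_scope.

Variables (R : realType) (m : nat) (sigma tau : 'S_m).
Local Notation Sigma := (origami R sigma tau).

Definition torus_eq (x y x' y' : R) : Prop :=
  exists n1 n2 : int, x = x' + n1%:~R /\ y = y' + n2%:~R.

Lemma torus_eq_refl x y : torus_eq x y x y.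
Proof. by exists 0, 0; rewrite !addr0. Qed.

Lemma torus_eq_sym x y x' y' : torus_eq x y x' y' -> torus_eq x' y' x y.
Proof. by move=> [a [b [-> ->]]]; exists (- a), (- b); rewrite !intrN !addrK. Qed.

Lemma torus_eq_trans x y x' y' x'' y'' :
  torus_eq x y x' y' -> torus_eq x' y' x'' y'' -> torus_eq x y x'' y''.
Proof.
move=> [a [b [-> ->]]] [c [d [-> ->]]]; exists (c + a), (d + b).
by rewrite !intrD !addrA.
Qed.

Lemma torus_eq_lin (g : SL2 int) x y x' y' : torus_eq x y x' y' ->
  torus_eq (lin1 g x y) (lin2 g x y) (lin1 g x' y') (lin2 g x' y').
Proof.
move=> [a [b [-> ->]]].
exists (g 0 0 * a + g 0 1 * b), (g 1 0 * a + g 1 1 * b).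
by rewrite /lin1 /lin2 !(intrD, intrM); split; ring.
Qed.

(** These coordinates depend on a chosen representative; modulo integers, that is up to [torus_eq],
    they describe the map from the surface to the torus. *)
Definition ocoord (q : Sigma) : usquare R :=
  (generic_quotient.repr (q : {eq_quot glued_equiv R sigma tau})).2.
Definition ocoord1 (q : Sigma) : R := (ocoord q).1%:num.
Definition ocoord2 (q : Sigma) : R := (ocoord q).2%:num.

Lemma optP (q : Sigma) : exists i p, q = opt sigma tau i p.
Proof.
exists (generic_quotient.repr (q : {eq_quot glued_equiv R sigma tau})).1, (ocoord q).
by rewrite /opt /ocoord -surjective_pairing reprK.
Qed.

Lemma glued_torus_eq (p q : squares R m) : glued sigma tau p q ->
  torus_eq p.2.1%:num p.2.2%:num q.2.1%:num q.2.2%:num.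
Proof.
move=> /asboolP; elim=> {p q}.
- move=> p q [i y|i x] /=.
    by exists (-1), 0; rewrite /= addr0 intrN subrr.
  by exists 0, 1; rewrite /= addr0 add0r.
- by move=> p; exact: torus_eq_refl.
- by move=> p q _; exact: torus_eq_sym.
- by move=> p q r _ h1 _; exact: torus_eq_trans.
Qed.

Lemma ocoord_opt i (p : usquare R) :
  torus_eq (ocoord1 (opt sigma tau i p)) (ocoord2 (opt sigma tau i p)) p.1%:num p.2%:num.
Proof.
apply: (@glued_torus_eq _ (i, p)).
by have := @reprK _ {eq_quot glued_equiv R sigma tau} (opt sigma tau i p) => /eqmodP.
Qed.

Lemma frac_part_torus_eq x y : torus_eq (frac_part x)%:num (frac_part y)%:num x y.
Proof.
exists (- Num.floor x), (- Num.floor y).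
by rewrite !intrN.
Qed.

Lemma frac_part_small (x : R) : 0 <= x < 1 -> (frac_part x)%:num = x.
Proof.
move=> /andP[x0 x1]; rewrite /=.
by rewrite (floor_def (m := 0)) ?subr0 // x0 add0r.
Qed.

Lemma origami_dist_opt i (p q : usquare R) :
  origami_dist (opt sigma tau i p) (opt sigma tau i q) <= eucl_dist p q.
Proof.
apply: ge_inf.
  by exists 0 => _ [s _ <-]; apply: sumr_ge0 => c _; exact: sqrtr_ge0.
exists [:: (i, (p, q))] => //.
by rewrite /broken_line_length big_seq1.
Qed.

Hypothesis trans_st :
  [transitive <<[set sigma; tau]%SET>>%g, on [set: 'I_m]%SET | 'P].

Lemma broken_line_cat (x y z : Sigma) s s' :
  broken_line x s y -> broken_line y s' z -> broken_line x (s ++ s') z.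
Proof.
by elim: s x => [|[i [p q]] s IH] x /= => [->//|[-> /IH h] /h].
Qed.

Lemma opt_glue_left i y :
  opt sigma tau i ((0%:i01 : {i01 R}), y) = opt sigma tau (sigma i) (1%:i01, y).
Proof. by apply/eqmodP/asboolP; apply: rst_step; exact: glue_left_right. Qed.

Lemma opt_glue_top i x :
  opt sigma tau i (x, (1%:i01 : {i01 R})) = opt sigma tau (tau i) (x, 0%:i01).
Proof. by apply/eqmodP/asboolP; apply: rst_step; exact: glue_top_bottom. Qed.

(** This keeps the infimum in [origami_dist] from ranging over the empty set. The set of reachable
    squares is stable under [sigma] and [tau], by passing through glued sides, so transitivity makes
    it everything. *)
Lemma origami_connected (x y : Sigma) : exists s, broken_line x s y.
Proof.
have [i [p ->]] := optP x; have [j [q ->]] := optP y => {x y}.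
pose J := [set j | `[< exists s (q : usquare R), broken_line (opt sigma tau i p) s (opt sigma tau j q) >]]%SET.
have move_in j' q' q'' s : broken_line (opt sigma tau i p) s (opt sigma tau j' q') ->
    exists s, broken_line (opt sigma tau i p) s (opt sigma tau j' q'').
  move=> h; exists (s ++ [:: (j', (q', q''))]).
  by apply: broken_line_cat h _.
have iJ : i \in J by rewrite !inE; exists [::], p.
have stJ (a : 'S_m) : (forall j', j' \in J -> a j' \in J) -> a \in 'N(J | 'P)%g.
  move=> aJ; rewrite !inE /=; apply/fintype.subsetP => j' /aJ h.
  rewrite !inE /= in h *; exact: h.
have /fintype.subsetP sub : (<<[set sigma; tau]%SET>> \subset 'N(J | 'P))%g.
  rewrite gen_subG; apply/fintype.subsetP => a /set2P[]->;
  apply: stJ => j'; rewrite !inE => -[s [q' h]].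
    have [s' h'] := move_in j' q' (0%:i01, 0%:i01) s h.
    by exists s', (1%:i01, 0%:i01); rewrite -opt_glue_left.
  have [s' h'] := move_in j' q' (0%:i01, 1%:i01) s h.
  by exists s', (0%:i01, 0%:i01); rewrite -opt_glue_top.
have [a aG ja] := atransP2 trans_st (finset.in_setT i) (finset.in_setT j).
have : j \in J by rewrite ja (astabs_act _ (sub _ aG)).
by rewrite !inE => -[s [q' h]]; exact: move_in h.
Qed.

Section Lifting.
Variables (Phi : R -> R -> R).
Hypothesis Phi_per : forall x y (n1 n2 : int), Phi (x + n1%:~R) (y + n2%:~R) = Phi x y.

Definition on_origami (q : Sigma) : R := Phi (ocoord1 q) (ocoord2 q).

Lemma Phi_torus_eq x y x' y' : torus_eq x y x' y' -> Phi x y = Phi x' y'.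
Proof. by move=> [a [b [-> ->]]]. Qed.

Lemma on_origami_opt i (p : usquare R) :
  on_origami (opt sigma tau i p) = Phi p.1%:num p.2%:num.
Proof. exact/Phi_torus_eq/ocoord_opt. Qed.

(** Periodicity makes the function independent of the square in which a point is read, so its
    variations along the segments of a broken line add up. *)
Lemma on_origami_lipschitz (t : R) : 0 < t ->
  (forall x y x' y' d, `|x - x'| <= d -> `|y - y'| <= d ->
     Phi x' y' <= Phi x y + t * d) ->
  forall x y, `|on_origami x - on_origami y| <= t * origami_dist x y.
Proof.
move=> t0 Lip x y; rewrite mulrC -ler_pdivrMr //.
have [s0 s0P] := origami_connected x y.
apply: lb_le_inf; first by exists (broken_line_length s0), s0.
move=> _ [s sP <-]; rewrite ler_pdivrMr // mulrC.
elim: s x sP {s0 s0P} => [|[i [p q]] s IH] x /=.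
  by move=> ->; rewrite subrr normr0 /broken_line_length big_nil mulr0.
move=> [-> /IH h]; rewrite /broken_line_length big_cons mulrDr.
apply: le_trans (ler_distD (on_origami (opt sigma tau i q)) _ _) _.
apply: lerD h; rewrite !on_origami_opt /=.
have d1 : `|p.1%:num - q.1%:num| <= eucl_dist p q.
  by rewrite -sqrtr_sqr ler_wsqrtr // lerDl sqr_ge0.
have d2 : `|p.2%:num - q.2%:num| <= eucl_dist p q.
  by rewrite -sqrtr_sqr ler_wsqrtr // lerDr sqr_ge0.
rewrite ler_distl; apply/andP; split.
  by rewrite lerBlDr; apply: Lip; rewrite // distrC.
by rewrite -lerBlDr lerBlDr; apply: Lip; rewrite distrC.
Qed.

End Lifting.

Variables (k : nat) (act : SL2 int -> Sigma -> Sigma).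
Hypothesis actP : multi_twist_action k act.

(** The map to the torus is equivariant: [hor_line] and [ver_line] change the linear image by
    integers only, and equivariance passes to products and inverses. *)
Lemma act_torus_eq g q : multi_twist_group k g ->
  torus_eq (ocoord1 (act g q)) (ocoord2 (act g q))
    (lin1 g (ocoord1 q) (ocoord2 q)) (lin2 g (ocoord1 q) (ocoord2 q)).
Proof.
have [a1 aM aU aL] := actP.
have [G1 GM GV] : subgroup (multi_twist_group k) := gen_subgroup_subgroup _.
pose H := [set g | multi_twist_group k g /\ forall q, torus_eq (ocoord1 (act g q)) (ocoord2 (act g q))
    (lin1 g (ocoord1 q) (ocoord2 q)) (lin2 g (ocoord1 q) (ocoord2 q))].
suff : multi_twist_group k `<=` H by move=> h /h[].
move=> {q} h; apply; split; last first.
  move=> h' h'E; split; first exact: sub_gen_subgroup.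
  move=> q; have [i [[x y] ->]] := optP q.
  have co := torus_eq_lin h' (ocoord_opt i (x, y)).
  apply: torus_eq_trans (torus_eq_sym co).
  case: h'E => ->.
    rewrite aU /hor_line; apply: torus_eq_trans (ocoord_opt _ _) _ => /=.
    exists (- Num.floor (x%:num + k%:R * y%:num)), 0.
    by rewrite /lin1 /lin2 /= !mxE /= intrN; split; ring.
  rewrite aL /ver_line; apply: torus_eq_trans (ocoord_opt _ _) _ => /=.
  exists 0, (- Num.floor (k%:R * x%:num + y%:num)).
  by rewrite /lin1 /lin2 /= !mxE /= intrN; split; ring.
split.
- by split => // q; rewrite a1 lin11 lin21; exact: torus_eq_refl.
- move=> g1 g2 [m1 h1] [m2 h2]; split; first exact: GM.
  move=> q; rewrite aM // lin1M lin2M; apply: torus_eq_trans (h1 _) _.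
  exact: torus_eq_lin.
- move=> g1 [m1 h1]; split; first exact: GV.
  move=> q; have := torus_eq_lin g1^-1%g (h1 (act g1^-1%g q)).
  rewrite -!lin1M -!lin2M mulVg lin11 lin21 -aM //; last exact: GV.
  by rewrite mulgV a1 => /torus_eq_sym.
Qed.

End OrigamiCoordinates.

(** * The warped cone over an origami surface *)

Section WarpedDistance.
Local Open Scope classical_set_scope.
Local Open Scope ring_scope.

Variables (R : realType) (Y : Type) (d : Y -> Y -> R).
Variables (T : groupType) (act : T -> Y -> Y) (S : set T) (t : R).
Local Notation admissible := (warped_admissible d act S t).
Local Notation wd := (warped_dist d act S t).

Lemma warped_dist_none y y' : ~ (exists rho, admissible rho) -> wd y y' = 0.
Proof.
move=> none; rewrite /warped_dist (_ : [set _ | _ in _] = set0) ?sup0 //.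
by rewrite -subset0 => x [rho adm _]; apply: none; exists rho.
Qed.

Lemma warped_dist_ge rho y y' : admissible rho -> rho y y' <= wd y y'.
Proof.
move=> adm; apply: ub_le_sup; last by exists rho.
by exists (t * d y y') => _ [rho' [_ h _] <-].
Qed.

Hypothesis adm_ex : exists rho, admissible rho.

Lemma warped_dist_le b y y' :
  (forall rho, admissible rho -> rho y y' <= b) -> wd y y' <= b.
Proof.
move=> h; apply: ge_sup; first by have [rho adm] := adm_ex; exists (rho y y'), rho.
by move=> _ [rho adm <-]; exact: h.
Qed.

Lemma warped_dist_metric y y' : wd y y' <= t * d y y'.
Proof. by apply: warped_dist_le => rho [_]. Qed.

Lemma warped_dist_act s y : S s -> wd y (act s y) <= 1.
Proof. by move=> Ss; apply: warped_dist_le => rho [_ _ h]; exact: h. Qed.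

Lemma warped_distxx y : wd y y <= 0.
Proof. by apply: warped_dist_le => rho [[h _ _] _ _]; rewrite (h y y).2. Qed.

Lemma warped_distC y y' : wd y y' = wd y' y.
Proof.
by rewrite /warped_dist; congr sup; apply/seteqP; split=> _ [rho adm <-];
  exists rho => //; have [[_ h _] _ _] := adm.
Qed.

Lemma warped_dist_triangle y y' y'' : wd y y'' <= wd y y' + wd y' y''.
Proof.
apply: warped_dist_le => rho adm; have [[_ _ h] _ _] := adm.
by apply: le_trans (h y y' y'') _; rewrite lerD // warped_dist_ge.
Qed.

End WarpedDistance.

(** * Crossing a large box with few shears and unit steps *)

Section GridPaths.

(* [E n p q] reads: [q] is within [n] moves of [p]. *)
Variables (k b : nat) (E : nat -> nat * nat -> nat * nat -> Prop).
Hypothesis E_refl : forall n p, E n p p.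
Hypothesis E_sym : forall n p q, E n p q -> E n q p.
Hypothesis E_trans : forall n n' p q r, E n p q -> E n' q r -> E (n + n') p r.
Hypothesis E_right : forall u v, u < b -> v < b -> E 1 (u, v) (u.+1, v).
Hypothesis E_up : forall u v, u < b -> v < b -> E 1 (u, v) (u, v.+1).
Hypothesis E_shear_right : forall u v, u + k * v < b -> v < b -> E 1 (u, v) (u + k * v, v).
Hypothesis E_shear_up : forall u v, u < b -> v + k * u < b -> E 1 (u, v) (u, v + k * u).

Lemma E_iter (f : nat -> nat * nat) n :
  (forall i, i < n -> E 1 (f i) (f i.+1)) -> E n (f 0) (f n).
Proof.
elim: n => [|n IH] h; first exact: E_refl.
have En : E n (f 0) (f n) by apply: IH => i lin; apply: h; exact: leqW.
by have := E_trans En (h n (ltnSn n)); rewrite addn1.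
Qed.

Lemma E_rights u v n : u + n <= b -> v < b -> E n (u, v) (u + n, v).
Proof.
move=> h1 h2; have := @E_iter (fun i => (u + i, v)) n; rewrite addn0; apply => i lin.
by rewrite addnS; apply: E_right => //; lia.
Qed.

Lemma E_ups u v n : v + n <= b -> u < b -> E n (u, v) (u, v + n).
Proof.
move=> h1 h2; have := @E_iter (fun i => (u, v + i)) n; rewrite addn0; apply => i lin.
by rewrite addnS; apply: E_up => //; lia.
Qed.

Lemma E_shears_right u v n : u + n * (k * v) < b -> v < b -> E n (u, v) (u + n * (k * v), v).
Proof.
move=> h1 h2; have := @E_iter (fun i => (u + i * (k * v), v)) n; rewrite addn0; apply => i lin.
have -> : u + i.+1 * (k * v) = u + i * (k * v) + k * v by rewrite mulSn; lia.
apply: E_shear_right => //; apply: leq_ltn_trans h1.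
by rewrite -addnA leq_add2l addnC -mulSn leq_mul2r lin orbT.
Qed.

Lemma E_shears_up u v n : v + n * (k * u) < b -> u < b -> E n (u, v) (u, v + n * (k * u)).
Proof.
move=> h1 h2; have := @E_iter (fun i => (u, v + i * (k * u))) n; rewrite addn0; apply => i lin.
have -> : v + i.+1 * (k * u) = v + i * (k * u) + k * u by rewrite mulSn; lia.
apply: E_shear_up => //; apply: leq_ltn_trans h1.
by rewrite -addnA leq_add2l addnC -mulSn leq_mul2r lin orbT.
Qed.

(* The commutator of a shear with a translation by [W] is a translation by
   [k * W], so translations by up to [W ^ 2] cost only [O(W)] moves. *)
Lemma grid_reach W u v : 0 < k -> 0 < W -> u < W ^ 2 -> v < W ^ 2 ->
  (k * W * (W ^ 2 + W) + 2 * W ^ 2 + W < b) ->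
  E ((7 + 2 * k) * W) (0, 0) (u, v).
Proof.
move=> k0 W0 uW vW hb.
have kW0 : 0 < k * W by rewrite muln_gt0 k0.
have WW : W <= W ^ 2 by rewrite expnS expn1 leq_pmulr.
have quo w : w < W ^ 2 -> w %/ (k * W) < W.
  by move=> wW; rewrite ltn_divLR //; apply: leq_trans wW _; rewrite mulnC -mulnA leq_pmull.
have rem w : w %% (k * W) < k * W by rewrite ltn_mod.
have dec w : w %/ (k * W) * (k * W) + w %% (k * W) = w by rewrite -divn_eq.
set j := u %/ (k * W); set i := v %/ (k * W).
have hj := quo u uW; have hi := quo v vW; have ru := rem u; have rv := rem v.
have du := dec u; have dv := dec v.
rewrite -/j in hj du; rewrite -/i in hi dv.
(* Climb to height [W], where each shear moves by [k * W]; shear [j] times, climb down and walk the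
   remainder. *)
have P1 : E (W + j + W + u %% (k * W)) (0, 0) (u, 0).
  apply: E_trans (_ : E _ _ (j * (k * W), 0)) _; last first.
    by rewrite -{2}du; apply: E_rights; lia.
  apply: E_trans (_ : E _ _ (j * (k * W), W)) _; last first.
    by apply: E_sym; rewrite -{2}[W]add0n; apply: E_ups; lia.
  apply: E_trans (_ : E _ _ (0, W)) _; first by rewrite -{2}[W]add0n; apply: E_ups; lia.
  by rewrite -[j * _]add0n; apply: E_shears_right; lia.
(* This is the greatest height visited by the second path and accounts for the cubic term in the
   bound on [b]. *)
have hik : i * (k * (u + W)) <= k * W * (W ^ 2 + W).
  by rewrite (mulnC k) mulnA -mulnA [k * W * _]mulnC mulnA; nia.
(* In column [u] a vertical shear moves by [k * u]. Shearing up [i] times in column [u + W] and down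
   [i] times in column [u] leaves the net translation [i * (k * W)]. *)
have P2 : E (W + i + W + i + v %% (k * W)) (u, 0) (u, v).
  have split_i : i * (k * (u + W)) = i * (k * W) + i * (k * u) by rewrite -mulnDr -mulnDr addnC.
  apply: E_trans (_ : E _ _ (u, i * (k * W))) _; last first.
    by rewrite -{2}dv; apply: E_ups; lia.
  apply: E_trans (_ : E _ _ (u, i * (k * (u + W)))) _; last first.
    by apply: E_sym; rewrite split_i; apply: E_shears_up; lia.
  apply: E_trans (_ : E _ _ (u + W, i * (k * (u + W)))) _; last first.
    by apply: E_sym; apply: E_rights; lia.
  apply: E_trans (_ : E _ _ (u + W, 0)) _; first by apply: E_rights; lia.
  by rewrite -[i * _]add0n; apply: E_shears_up; lia.
have := E_trans P1 P2; set N := (X in E X) => EN.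
(* There are four legs of length [W], the counts [j], [i], [i] below [W], and two remainders below
   [k * W]. *)
have NW : N <= (7 + 2 * k) * W by rewrite /N; nia.
by rewrite -(subnKC NW); apply: E_trans EN _; exact: E_refl.
Qed.

End GridPaths.

Section OrigamiCone.
Local Open Scope classical_set_scope.
Local Open Scope ring_scope.

Variables (R : realType) (m : nat) (sigma tau : 'S_m).
Local Notation Sigma := (origami R sigma tau).
Local Notation dist := (origami_dist (R := R) (sigma := sigma) (tau := tau)).
Variables (k : nat) (act : SL2 int -> Sigma -> Sigma) (S : set (SL2 int)).
Hypothesis actP : multi_twist_action k act.
Hypothesis S_gen : finite_symmetric_generating (multi_twist_group k) S.

Local Notation wd t := (warped_dist dist act S t).

Lemma warped_dist_word (t : R) n g y :
  (exists rho, warped_admissible dist act S t rho) ->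
  word_ball S n g -> wd t y (act g y) <= n%:R.
Proof.
move=> adm [w [wn wS ->]]; have [_ Ssym Sgen] := S_gen.
have [a1 aM _ _] := actP.
apply: (@le_trans _ _ (size w)%:R); last by rewrite ler_nat.
elim: w wS {wn} => [|x w IH] wS; first by rewrite big_nil a1 warped_distxx.
have xS : S x by have [//|/Ssym] := wS x (mem_head _ _); rewrite invgK.
have wS' z : z \in w -> S z \/ S z^-1%g by move=> zw; apply: wS; rewrite inE zw orbT.
have inG z : word_ball S (size w) z -> multi_twist_group k z.
  by rewrite -Sgen; exact: word_ball_gen.
rewrite big_cons aM; last 2 first.
- by rewrite -Sgen; exact: sub_gen_subgroup.
- by apply: inG; exists w.
apply: le_trans (warped_dist_triangle adm _ (act (\prod_(z <- w) z)%g y) _) _.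
by rewrite /= -natr1 lerD ?IH // warped_dist_act.
Qed.

Variable i0 : 'I_m.

Definition grid_point (T u v : nat) : Sigma :=
  opt sigma tau i0 (frac_part (u%:R / T%:R), frac_part (v%:R / T%:R)).

Lemma frac_grid (T u : nat) : (u < T)%N ->
  (frac_part (u%:R / T%:R : R))%:num = u%:R / T%:R.
Proof.
move=> uT; have T0 : 0 < T%:R :> R by rewrite ltr0n; lia.
by rewrite frac_part_small // divr_ge0 //= ltr_pdivrMr // mul1r ltr_nat.
Qed.

(** As long as the sheared point stays in the square [i0], the floor in [hor_line] is 0 and the
    twist acts linearly. *)
Lemma upper_grid (T u v : nat) : (u + k * v < T)%N -> (v < T)%N ->
  act (upper k%:Z) (grid_point T u v) = grid_point T (u + k * v) v.
Proof.
move=> h1 h2; have [_ _ aU _] := actP.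
have T0 : 0 < T%:R :> R by rewrite ltr0n; lia.
rewrite /grid_point aU !frac_grid //; last by lia.
have E : u%:R / T%:R + k%:R * (v%:R / T%:R) = (u + k * v)%:R / T%:R :> R.
  by rewrite natrD natrM; field; rewrite gt_eqF.
rewrite E /hor_line.
have -> : Num.floor ((u + k * v)%:R / T%:R : R) = 0.
  apply: floor_def; rewrite add0r divr_ge0 //= ltr_pdivrMr // mul1r.
  by rewrite ltr_nat.
by rewrite oppr0 (_ : perm_powz sigma 0 = 1%g) ?perm1 //; exact: expg0.
Qed.

Lemma lower_grid (T u v : nat) : (u < T)%N -> (v + k * u < T)%N ->
  act (lower k%:Z) (grid_point T u v) = grid_point T u (v + k * u).
Proof.
move=> h1 h2; have [_ _ _ aL] := actP.
have T0 : 0 < T%:R :> R by rewrite ltr0n; lia.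
rewrite /grid_point aL !frac_grid //; last by lia.
have E : k%:R * (u%:R / T%:R) + v%:R / T%:R = (v + k * u)%:R / T%:R :> R.
  by rewrite natrD natrM; field; rewrite gt_eqF.
rewrite E /ver_line.
have -> : Num.floor ((v + k * u)%:R / T%:R : R) = 0.
  apply: floor_def; rewrite add0r divr_ge0 //= ltr_pdivrMr // mul1r.
  by rewrite ltr_nat.
by rewrite (_ : perm_powz tau 0 = 1%g) ?perm1 //; exact: expg0.
Qed.

Lemma warped_dist_right (T u v : nat) : (u.+1 < T)%N -> (v < T)%N ->
  (exists rho, warped_admissible dist act S T%:R rho) ->
  wd T%:R (grid_point T u v) (grid_point T u.+1 v) <= 1.
Proof.
move=> uT vT adm; have T0 : 0 < T%:R :> R by rewrite ltr0n; lia.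
apply: le_trans (warped_dist_metric adm _ _) _.
rewrite mulrC -ler_pdivlMr // mul1r.
apply: le_trans (origami_dist_opt _ _ _ _ _) _.
rewrite /eucl_dist !frac_grid ?(ltnW uT) ?(ltnW vT) //=.
rewrite subrr expr0n addr0 sqrtr_sqr -mulrBl normrM [`|T%:R^-1|]ger0_norm ?invr_ge0 ?ler0n //.
rewrite (_ : u%:R - u.+1%:R = -1); last by rewrite -natr1; ring.
by rewrite normrN1 mul1r.
Qed.

Lemma warped_dist_up (T u v : nat) : (u < T)%N -> (v.+1 < T)%N ->
  (exists rho, warped_admissible dist act S T%:R rho) ->
  wd T%:R (grid_point T u v) (grid_point T u v.+1) <= 1.
Proof.
move=> uT vT adm; have T0 : 0 < T%:R :> R by rewrite ltr0n; lia.
apply: le_trans (warped_dist_metric adm _ _) _.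
rewrite mulrC -ler_pdivlMr // mul1r.
apply: le_trans (origami_dist_opt _ _ _ _ _) _.
rewrite /eucl_dist !frac_grid ?(ltnW uT) ?(ltnW vT) //=.
rewrite subrr expr0n add0r sqrtr_sqr -mulrBl normrM [`|T%:R^-1|]ger0_norm ?invr_ge0 ?ler0n //.
rewrite (_ : v%:R - v.+1%:R = -1); last by rewrite -natr1; ring.
by rewrite normrN1 mul1r.
Qed.

Hypothesis trans_st :
  [transitive <<[set sigma; tau]%SET>>%g, on [set: 'I_m]%SET | 'P].

(* The orbit cost only yields a pseudo-metric, whence the maximum with an
   arbitrary admissible metric. *)
Lemma orbit_cost_le_warped (r L T u0 v0 u v : nat) : (0 < T)%N -> (0 < L)%N ->
  (forall g, word_ball S r g -> (sl2_height g <= L)%N) ->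
  (exists rho, warped_admissible dist act S T%:R rho) ->
  orbit_cost S r L T%:R (u0%:R / T%:R) (v0%:R / T%:R) (u%:R / T%:R) (v%:R / T%:R)
  <= wd T%:R (grid_point T u0 v0) (grid_point T u v).
Proof.
move=> T0' L0 hL [rho0 [[r0 rC rT] rd rS]].
have [_ Ssym Sgen] := S_gen.
have T0 : 0 < T%:R :> R by rewrite ltr0n.
set Phi := orbit_cost _ _ _ _ _ _.
have per x y (n1 n2 : int) : Phi (x + n1%:~R) (y + n2%:~R) = Phi x y.
  exact: orbit_cost_periodic.
pose h := @on_origami R m sigma tau Phi.
have hgrid a b : h (grid_point T a b) = Phi (a%:R / T%:R) (b%:R / T%:R).
  rewrite /h /grid_point on_origami_opt //=.
  exact: (Phi_torus_eq per (frac_part_torus_eq _ _)).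
pose rho (x y : Sigma) := Num.max (rho0 x y) `|h x - h y|.
have rho_adm : warped_admissible dist act S T%:R rho.
  split; first split.
  - move=> x y; split=> [e|->]; last first.
      by rewrite /rho subrr normr0 (r0 y y).2 // maxxx.
    apply/r0/le_anti/andP; split; first by rewrite -e /rho le_max lexx.
    have : 0 <= rho0 x y + rho0 y x by rewrite -(_ : rho0 x x = 0) ?rT //; exact/r0.
    by rewrite [rho0 y x]rC; lra.
  - by move=> x y; rewrite /rho rC distrC.
  - move=> x y z; rewrite /rho ge_max; apply/andP; split.
      by apply: le_trans (rT x y z) _; rewrite lerD // le_max lexx.
    by apply: le_trans (ler_distD (h y) _ _) _; rewrite lerD // le_max lexx orbT.
  - move=> x y; rewrite /rho ge_max rd /=; apply: on_origami_lipschitz => //.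
    by move=> *; exact: orbit_cost_lipschitz.
  - move=> s y Ss; rewrite /rho ge_max rS //=.
    rewrite /h {2}/on_origami (Phi_torus_eq per (act_torus_eq actP y (_ : multi_twist_group k s)));
      last by rewrite -Sgen; exact: sub_gen_subgroup.
    by rewrite distrC; apply: orbit_cost_step_dist => //; left.
apply: le_trans (warped_dist_ge _ _ rho_adm).
rewrite /rho !hgrid /Phi orbit_cost_base // -/Phi sub0r normrN le_max.
by apply/orP; right; exact: ler_norm.
Qed.

End OrigamiCone.

(** * Composing coarse maps *)

Section CoarseComposition.
Local Open Scope classical_set_scope.
Local Open Scope ring_scope.

Variable R : realType.

(** The map [F] is the coarse embedding after a coarse inverse of the quasi-isometry. The axioms on
    [dY] are asked for each [n] separately, since admissible warped metrics are obtained for large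
    [n] only. *)
Lemma quasi_isometric_coarsely_embeds (X Y Z : nat -> Type)
    (dX : forall n, X n -> X n -> R) (dY : forall n, Y n -> Y n -> R)
    (dZ : forall n, Z n -> Z n -> R) (c : R) :
  quasi_isometric dX dY -> coarsely_embeds dX dZ -> 0 <= c ->
  (forall n x x', 0 <= dX n x x') ->
  exists r D : R, forall n,
    (forall y y', dY n y y' = dY n y' y) ->
    (forall x y z, dY n x z <= dY n x y + dY n y z) ->
  exists F : Y n -> Z n,
    (forall y y', dY n y y' <= c -> dZ n (F y) (F y') <= D) /\
    (forall y y', dZ n (F y) (F y') <= 0 -> dY n y y' <= r).
Proof.
move=> [f [L [A [L1 A0 fqi fsurj]]]] [e [eta [zeta [[eta0 zeta0] [etam zetam] etaoo ebd]]]] c0 dX0.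
have L0 : 0 < L by lra.
have [r1 [r10 r1P]] : exists r1, 0 <= r1 /\ forall s, 0 <= s -> eta s <= 0 -> s <= r1.
  have /cvgryPgt/(_ 0)[r1 [_ h]] := etaoo.
  exists (Num.max 0 r1); split; first by rewrite le_max lexx.
  move=> s s0 es; rewrite leNgt; apply/negP; rewrite gt_max => /andP[_ /h].
  by rewrite ltNge es.
exists (L * r1 + A + 2 * (A + 1)), (zeta (L * (c + 2 * (A + 1) + A))) => n dC dT.
(* The infimum in the density condition may not be attained, whence [A + 1] in place of [A]. *)
have /choice[g gP] y : exists x, dY n y (f n x) <= A + 1.
  have [|_ [_ [x _ <-] <-]] := @ereal_inf_lt R [set (dY n y z)%:E | z in range (f n)] (A + 1)%:E.
    by apply: le_lt_trans (fsurj n y) _; rewrite lte_fin ltrDl.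
  by rewrite lte_fin => /ltW h; exists x.
exists (e n \o g); split=> y y' h /=.
  have /andP[_ h2] := ebd n (g y) (g y'); apply: le_trans h2 _.
  apply: zetam; first exact: dX0.
  have /andP[h3 _] := fqi n (g y) (g y').
  have : L^-1 * dX n (g y) (g y') <= c + 2 * (A + 1) + A.
    have := dT (f n (g y)) y (f n (g y')); have := dT y y' (f n (g y')).
    have := gP y; have := gP y'; rewrite (dC y); lra.
  by rewrite ler_pdivrMl.
have /andP[h1 _] := ebd n (g y) (g y').
have h2 := r1P _ (dX0 _ _ _) (le_trans h1 h).
have /andP[_ h3] := fqi n (g y) (g y').
have h4 : L * dX n (g y) (g y') <= L * r1 by rewrite ler_wpM2l // ltW.
have := dT y (f n (g y)) y'; have := dT (f n (g y)) (f n (g y')) y'.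
have := gP y; have := gP y'; rewrite (dC y'); lra.
Qed.

Lemma expander_unbounded (X : nat -> sgraph) (b : R) : expander R X ->
  exists n0, forall n, (n0 <= n)%N -> exists x y : X n, b < gdist R x y.
Proof.
move=> Xexp; have [/cvgnyPgt Xoo [D degD] _] := Xexp.
pose N := Num.bound `|b|.
have [n0 _ n0P] := Xoo (D.+1 ^ N)%N.
exists n0 => n /n0P; rewrite ltnNge /= => /negP big.
apply: contrapT => small; apply: big.
have [x _|X0] := pickP (X n); last first.
  by rewrite (eq_card0 X0).
apply: (walk_card (x := x)) => [|y]; first exact: degD.
apply: (gdist_walk (R := R)); first exact: expander_connected Xexp.
rewrite leNgt; apply/negP => h; apply: small; exists x, y.
apply: lt_trans h; apply: le_lt_trans (ler_norm b) _.
exact: archi_boundP.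
Qed.

End CoarseComposition.

(** * Transporting the grids from the cone to the box space *)

Section NoEmbedding.
Local Open Scope classical_set_scope.
Local Open Scope ring_scope.

Variables (R : realType) (m : nat) (sigma tau : 'S_m).
Local Notation dist := (origami_dist (R := R) (sigma := sigma) (tau := tau)).
Hypothesis m_gt0 : (0 < m)%N.
Hypothesis trans_st :
  [transitive <<[set sigma; tau]%SET>>%g, on [set: 'I_m]%SET | 'P].
Variables (k : nat) (act : SL2 int -> origami R sigma tau -> origami R sigma tau).
Hypothesis k_gt0 : (0 < k)%N.
Hypothesis actP : multi_twist_action k act.
Variable S : set (SL2 int).
Hypothesis S_gen : finite_symmetric_generating (multi_twist_group k) S.
Variable Gamma : nat -> sgraph.
Hypothesis Gamma_expander : expander R Gamma.
Hypothesis Gamma_cone :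
  quasi_isometric (fun n => gdist R (X := Gamma n)) (warped_cone dist act S).

(** Without admissible metrics the warped distance is the supremum of the empty set, that is 0, and
    the quasi-isometry would bound the diameter of [Gamma n] by [L * A]. *)
Lemma warped_cone_admissible : exists n0, forall n, (n0 <= n)%N ->
  exists rho, warped_admissible dist act S n.+1%:R rho.
Proof.
have [f [L [A [L1 A0 fqi _]]]] := Gamma_cone.
have [n0 n0P] := expander_unbounded (L * A) Gamma_expander.
exists n0 => n /n0P[x [y xy]]; apply: contrapT => none.
have /andP[h _] := fqi n x y.
rewrite /warped_cone warped_dist_none // lerBlDr add0r ler_pdivrMl ?(lt_le_trans ltr01) // in h.
by rewrite ltNge h in xy.
Qed.

Lemma cone_not_into_grid_free (T : groupType) (G : set T) (Lambda : nat -> sgraph) :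
  grid_free G -> box_space G Lambda -> expander R Lambda ->
  ~ coarsely_embeds (fun n => gdist R (X := Gamma n))
      (fun n => gdist R (X := Lambda n)).
Proof.
move=> Gfree box Lexp emb.
have [Sfin _ Sgen] := S_gen.
have [l [l1 lU lL]] : exists l, [/\ (0 < l)%N, word_ball S l (upper k%:Z) & word_ball S l (lower k%:Z)].
  have [|a aU] := @gen_word_ball _ S (upper k%:Z).
    by rewrite Sgen; apply: sub_gen_subgroup; left.
  have [|b bL] := @gen_word_ball _ S (lower k%:Z).
    by rewrite Sgen; apply: sub_gen_subgroup; right.
  by exists (a + b).+1; split => //; [apply: word_ballS aU|apply: word_ballS bL]; lia.
(* All moves on the grid, unit steps as well as twists, have warped length at most [l], so their
   images are at distance at most [D]. *)
have [r [D rD]] := quasi_isometric_coarsely_embeds Gamma_cone emb (ler0n R l)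
  (fun n x x' => gdist_ge0 R x x').
pose r' := Num.bound `|r|; pose D' := Num.bound `|D|.
have rr' : r <= r'%:R by apply/ltW/(le_lt_trans (ler_norm r))/archi_boundP.
have DD' : D <= D'%:R by apply/ltW/(le_lt_trans (ler_norm D))/archi_boundP.
have [L [L0 hL]] := word_ball_height r'.+1 Sfin.
have [C0 C0P] := orbit_cost_count R Sfin L0 hL.
have [W0 W0P] := box_space_grid_free Gfree box D' C0 ((7 + 2 * k) * D').
(* A single grid size is enough; the successor makes it positive, as [grid_reach] requires. *)
have [n0 n0P] := W0P W0.+1 (leqnSn _).
have [n1 n1P] := warped_cone_admissible.
set W := W0.+1 in n0P.
have [T0 T0P] := C0P (W ^ 2)%N.
pose b := (k * W * (W ^ 2 + W) + 2 * W ^ 2 + W).+1.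
(* This exceeds the thresholds for lifting, for admissible metrics and for counting, and leaves room
   for the box of side [b] inside one square at mesh [1 / n.+1]. *)
pose n := (n0 + n1 + T0 + b)%N.
have adm : exists rho, warped_admissible dist act S n.+1%:R rho by apply: n1P; rewrite /n; lia.
have [F [FD Fr]] := rD n (fun y y' => warped_distC _ _ _ _ y y') (warped_dist_triangle adm).
have [//|] := n0P n; first by rewrite /n; lia.
pose i0 : 'I_m := Ordinal m_gt0.
pose gp (p : nat * nat) := grid_point R sigma tau i0 n.+1 p.1 p.2.
have bn : (b <= n)%N by rewrite /n; lia.
pose E N p q := walk (N * D') (F (gp p)) (F (gp q)).
have stepE p q : warped_dist dist act S n.+1%:R (gp p) (gp q) <= l%:R -> E 1 p q.
  move=> h; rewrite /E mul1n; apply: (gdist_walk (R := R)).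
    exact: expander_connected Lexp.
  by apply: le_trans DD'; exact: FD.
have l1R : 1 <= l%:R :> R by rewrite (ler_nat R 1).
have E_refl N p : E N p p by exact: walk0.
have E_sym N p q : E N p q -> E N q p by exact: walk_sym.
have E_trans N N' p q s : E N p q -> E N' q s -> E (N + N')%N p s.
  by rewrite /E mulnDl; exact: walk_trans.
have E_right u v : (u < b)%N -> (v < b)%N -> E 1%N (u, v) (u.+1, v).
  by move=> ub vb; apply: stepE; apply: le_trans l1R; apply: warped_dist_right => //=; lia.
have E_up u v : (u < b)%N -> (v < b)%N -> E 1%N (u, v) (u, v.+1).
  by move=> ub vb; apply: stepE; apply: le_trans l1R; apply: warped_dist_up => //=; lia.
have E_sr u v : (u + k * v < b)%N -> (v < b)%N -> E 1%N (u, v) ((u + k * v)%N, v).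
  move=> ub vb; apply: stepE; rewrite /gp /= -(upper_grid actP); [|lia..].
  exact: (warped_dist_word actP S_gen _ adm lU).
have E_su u v : (u < b)%N -> (v + k * u < b)%N -> E 1%N (u, v) (u, (v + k * u)%N).
  move=> ub vb; apply: stepE; rewrite /gp /= -(lower_grid actP); [|lia..].
  exact: (warped_dist_word actP S_gen _ adm lL).
have Wb : (W ^ 2 <= b)%N by rewrite /b; lia.
exists (F (gp (0, 0)%N)), (fun p : 'I_(W ^ 2) * 'I_(W ^ 2) => F (gp (p.1 : nat, p.2 : nat))).
split.
- move=> [p1 p2] /=; rewrite mulnAC; apply: (grid_reach (k := k) (b := b) (E := E)) => //.
- move=> [p1 p2] [q1 q2] /=.
  have nb u v : neighb u v -> [\/ u = v, u.+1 = v | v.+1 = u].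
    rewrite /neighb => /andP[h1 h2]; have : (u = v \/ u.+1 = v \/ v.+1 = u) by lia.
    by case=> [|[]] ?; [constructor 1|constructor 2|constructor 3].
  have lt (p : 'I_(W ^ 2)) : (p < b)%N by apply: leq_trans Wb.
  rewrite -[X in walk X]mul1n -/(E 1%N (p1 : nat, p2 : nat) (q1 : nat, q2 : nat)).
  rewrite /grid_adj /= => /orP[/andP[/eqP-> /nb[->|<-|<-]]|/andP[/nb[->|<-|<-] /eqP->]] //.
  + exact: E_up.
  + by apply: E_sym; exact: E_up.
  + exact: E_right.
  + by apply: E_sym; exact: E_right.
(* Grid points with the same image are at warped distance at most [r'], hence have orbit cost at
   most [r'] from any one of them, and [C0] bounds their number. *)
- move=> x; set B := [set p | _]%SET.
  have [->|[p0]] := set_0Vmem B; first by rewrite cards0.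
  rewrite inE => /eqP p0x; apply: leq_trans (T0P n.+1 _ p0); last by rewrite /n; lia.
  apply: subset_leq_card; apply/fintype.subsetP => p; rewrite !inE => /eqP px.
  have h := orbit_cost_le_warped actP S_gen i0 trans_st p0.1 p0.2 p.1 p.2 (ltn0Sn n) L0 hL adm.
  apply: le_trans h _.
  apply: le_trans rr'; apply: Fr.
  by have := walk_gdist R (walk0 0 x); rewrite -{1}p0x -px.
Qed.

End NoEmbedding.

Theorem theorem5 (R : realType) (m : nat) (sigma tau : 'S_m)
    (m_gt0 : (1 <= m)%N)
    (transitive_sigma_tau :
       [transitive <<[set sigma; tau]%SET>>%g, on [set: 'I_m]%SET | 'P])
    (k : nat) (k_ge2 : (2 <= k)%N)
    (sigma_k : (#[sigma]%g %| k)%N) (tau_k : (#[tau]%g %| k)%N)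
    (act : SL2 int -> origami R sigma tau -> origami R sigma tau)
    (act_twist : multi_twist_action k act)
    (S : set (SL2 int))
    (S_gen : finite_symmetric_generating (multi_twist_group k) S)
    (Gamma : nat -> sgraph)
    (Gamma_expander : expander R Gamma)
    (Gamma_cone :
       quasi_isometric (fun n => gdist R (X := Gamma n))
         (warped_cone (origami_dist (R := R) (sigma := sigma) (tau := tau))
            act S)) :
  ~ exists2 Lambda : nat -> sgraph, selberg_type R Lambda &
      coarsely_embeds (fun n => gdist R (X := Gamma n))
        (fun n => gdist R (X := Lambda n)).
Proof.
have k_gt0 : (0 < k)%N := ltnW k_ge2.
move=> [Lambda [Lambda_expander Lambda_box] emb].
have not_emb := cone_not_into_grid_free m_gt0 transitive_sigma_tau k_gt0 act_twist
  S_gen Gamma_expander Gamma_cone.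
by case: Lambda_box => -[G [G_sub G_disc G_box]]; apply: not_emb G_box Lambda_expander emb;
  [exact: psl2_discrete_grid_free|exact: sl2_discrete_grid_free].
Qed.
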